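(* Let $V$ be a simple, corational graded vertex operator coalgebra with $\rho\in V_2^*$ such that every admissible $V$-comodule under consideration has finite-dimensional homogeneous subspaces and all fusion rules defined by cointertwining operators are finite. Let $\mathcal M^i,\mathcal M^j,\mathcal M^k$ be admissible $V$-comodules with finite-dimensional homogeneous subspaces. Then $$N^{\mathcal M^i,\mathcal M^j}_{\mathcal M^k}=N^{(\mathcal M^k)'}_{(\mathcal M^i)',(\mathcal M^j)'},$$ where the left side is the fusion rule of cointertwining operators for $V$ and the right side is the fusion rule of intertwining operators among the modules $(\mathcal M^i)',(\mathcal M^j)',(\mathcal M^k)'$ over the dual vertex operator algebra $V'$.
   Context: Everything is over $\mathbb C$; $\tau(v\otimes w)=w\otimes v$; $\delta(x)=\sum_{n\in\mathbb Z}x^n$; $(z_1+z_2)^n$ is expanded in nonnegative powers of the second variable; $W\{z\}=\{\sum_{k\in\mathbb C}w_kz^k: w_k\in W\}$; $(\cdot,\cdot)$ is the natural pairing of a space with its dual. A graded vertex operator coalgebra is a tuple $(V,\Upsilon(z),c,\rho)$: a $\mathbb Z$-graded space $V=\bigoplus_s V_s$ with $\dim V_s<\infty$, $V_s=0$ for $s\ll0$; linear maps $c,\rho:V\to\mathbb C$; a linear map $\Upsilon(z):V\to (V\otimes V)[[z,z^{-1}]]$, $v\mapsto\sum_{k\in\mathbb Z}\Delta_k(v)z^{-k-1}$, such that: (i) each $\Delta_k(v)\in V\otimes V$ and $\Delta_k(v)=0$ for $k\ll0$; $\Delta_k(V_s)\subset (V\otimes V)_{s+k+1}$; (ii) $(c\otimes\mathrm{Id})\Upsilon(z)v=v$,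 $(\mathrm{Id}\otimes c)\Upsilon(z)v\in V[[z]]$, with limit $v$ as $z\to0$; (iii) Jacobi identity $$z_0^{-1}\delta\big(\tfrac{z_1-z_2}{z_0}\big)(\mathrm{Id}\otimes\Upsilon(z_2))\Upsilon(z_1)-z_0^{-1}\delta\big(\tfrac{z_2-z_1}{-z_0}\big)(\tau\otimes\mathrm{Id})(\mathrm{Id}\otimes\Upsilon(z_1))\Upsilon(z_2)=z_1^{-1}\delta\big(\tfrac{z_2+z_0}{z_1}\big)(\Upsilon(z_0)\otimes\mathrm{Id})\Upsilon(z_2);$$ (iv) writing $(\rho\otimes\mathrm{Id})\Upsilon(z)=\sum_kL_V(k)z^{k-2}$ with $L_V(k)\in\mathrm{End}(V)$, one has $[L_V(k),L_V(j)]=(k-j)L_V(k+j)+\frac{k^3-k}{12}\delta_{k+j,0}d$ for a constant $d\in\mathbb C$ (the rank); $V_s$ is the eigenspace of $L_V(0)$ with eigenvalue $s$; and $(L_V(1)\otimes\mathrm{Id})\Upsilon(z)=\frac{d}{dz}\Upsilon(z)=\Upsilon(z)L_V(1)-(\mathrm{Id}\otimes L_V(1))\Upsilon(z)$. An admissible $V$-comodule $(\mathcal M,\Upsilon_{\mathcal M}(z))$ is an $\mathbb N$-graded space $\mathcal M=\bigoplus_{t\in\mathbb N}M(t)$ with a linear map $\Upsilon_{\mathcal M}(z):\mathcal M\to (V\otimes\mathcal M)[[z,z^{-1}]]$, $\Upsilon_{\mathcal M}(z)=\sum_k\Delta_{\mathcal M,k}z^{-k-1}$, such that: each $\Delta_{\mathcal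 M,k}(m)\in V\otimes \mathcal M$ is a finite sum and vanishes for $k\ll0$; $(c\otimes\mathrm{Id})\Upsilon_{\mathcal M}(z)m=m$; the Jacobi identity $$z_0^{-1}\delta\big(\tfrac{z_1-z_2}{z_0}\big)(\mathrm{Id}\otimes\Upsilon_{\mathcal M}(z_2))\Upsilon_{\mathcal M}(z_1)-z_0^{-1}\delta\big(\tfrac{z_2-z_1}{-z_0}\big)(\tau\otimes\mathrm{Id})(\mathrm{Id}\otimes\Upsilon_{\mathcal M}(z_1))\Upsilon_{\mathcal M}(z_2)=z_1^{-1}\delta\big(\tfrac{z_2+z_0}{z_1}\big)(\Upsilon(z_0)\otimes\mathrm{Id})\Upsilon_{\mathcal M}(z_2);$$ writing $(\rho\otimes\mathrm{Id})\Upsilon_{\mathcal M}(z)=\sum_kL_V(k)z^{k-2}$ with $L_V(k)\in\mathrm{End}(\mathcal M)$, the same Virasoro relations hold on $\mathcal M$; $(L_V(1)\otimes\mathrm{Id})\Upsilon_{\mathcal M}(z)=\frac{d}{dz}\Upsilon_{\mathcal M}(z)=\Upsilon_{\mathcal M}(z)L_V(1)-(\mathrm{Id}\otimes L_V(1))\Upsilon_{\mathcal M}(z)$; and $\Delta_{\mathcal M,k}(M(t))\subset\bigoplus_{s\in\mathbb N}V_{t+k+1-s}\otimes M(s)$. $\mathcal M$ is simple if it has no nontrivial admissible subcomodule, cosemisimple if it is a direct sum of simple admissible subcomodules. $V$ is simple if it is simple as a comodule over itself, and corational if every admissible $V$-comodule is cosemisimple. A cointertwining operator of type $\binom{\mathcal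 M^1\ \mathcal M^2}{\mathcal M^3}$ is a linear map $\mathcal W(z):\mathcal M^3\to(\mathcal M^1\otimes\mathcal M^2)\{z\}$, $m^3\mapsto\sum_{t\in\mathbb C}\Delta_t(m^3)z^{-t-1}$, $\Delta_t(m^3)\in\mathcal M^1\otimes\mathcal M^2$, such that $\Delta_t(m^3)=0$ when the real part of $t$ is sufficiently small; $\frac{d}{dz}\mathcal W(z)=(L_V(1)\otimes\mathrm{Id})\mathcal W(z)$; and $$z_0^{-1}\delta\big(\tfrac{z_1-z_2}{z_0}\big)(\mathrm{Id}\otimes\mathcal W(z_2))\Upsilon_{\mathcal M^3}(z_1)-z_0^{-1}\delta\big(\tfrac{z_2-z_1}{-z_0}\big)(\tau\otimes\mathrm{Id})(\mathrm{Id}\otimes\Upsilon_{\mathcal M^2}(z_1))\mathcal W(z_2)=z_1^{-1}\delta\big(\tfrac{z_2+z_0}{z_1}\big)(\Upsilon_{\mathcal M^1}(z_0)\otimes\mathrm{Id})\mathcal W(z_2).$$ They form a vector space of dimension $N^{\mathcal M^1,\mathcal M^2}_{\mathcal M^3}$. Duals (known): $V'=\bigoplus_sV_s^*$ is a vertex operator algebra with vacuum $c$, conformal vector $\rho$ and $(Y(f,z)g,v)=(f\otimes g,\Upsilon(z)v)$; for $V$ simple corational it is rational. $\mathcal M'=\bigoplus_sM(s)^*$ is an admissible $V'$-module via $(Y_{\mathcal M'}(f,z)m^*,m)=(f\otimes m^*,\Upsilon_{\mathcal M}(z)m)$. For modules $\mathcal N_1,\mathcal N_2,\mathcal N_3$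 over a vertex operator algebra $\mathcal V$, an intertwining operator of type $\binom{\mathcal N_3}{\mathcal N_1\ \mathcal N_2}$ is a linear map $\mathcal Y(\cdot,z):\mathcal N_1\to\mathrm{Hom}(\mathcal N_2,\mathcal N_3)\{z\}$, $n_1\mapsto\sum_{t\in\mathbb C}n_{1,t}z^{-t-1}$, such that $n_{1,t+\lambda}n_2=0$ for each $\lambda\in\mathbb C$ and integers $t\gg0$; $\frac{d}{dz}\mathcal Y(n_1,z)=\mathcal Y(L(-1)n_1,z)$; and $$z_0^{-1}\delta\big(\tfrac{z_1-z_2}{z_0}\big)Y_{\mathcal N_3}(v,z_1)\mathcal Y(n_1,z_2)-z_0^{-1}\delta\big(\tfrac{-z_2+z_1}{z_0}\big)\mathcal Y(n_1,z_2)Y_{\mathcal N_2}(v,z_1)=z_2^{-1}\delta\big(\tfrac{z_1-z_0}{z_2}\big)\mathcal Y(Y_{\mathcal N_1}(v,z_0)n_1,z_2)$$ for $v\in\mathcal V$. The dimension of the space of these is $N^{\mathcal N_3}_{\mathcal N_1,\mathcal N_2}$. *)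

(* Defs.v *)
From HB Require Import structures.
From mathcomp Require Import all_boot all_order all_algebra.
From mathcomp Require Import complex.
From mathcomp Require Import boolp classical_sets functions cardinality fsbigop.
From mathcomp Require Import reals.

Set Implicit Arguments.
Unset Strict Implicit.
Unset Printing Implicit Defensive.
Import Order.TTheory GRing.Theory Num.Theory.
Local Open Scope quotient_scope.
Local Open Scope classical_set_scope.
Local Open Scope ring_scope.

Section LinearAlgebra.
Variables (K : comNzRingType) (U : lmodType K).

Definition subspace (N : set U) : Prop :=
  N 0 /\ forall a u v, N u -> N v -> N (a *: u + v).

Definition span (X : set U) : set U := smallest subspace X.

Definition has_dim (N : set U) (n : nat) : Prop :=
  exists e : 'I_n -> U, (forall i, N (e i)) /\
    forall u, N u -> exists! a : 'I_n -> K, u = \sum_(i < n) a i *: e i.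

Definition fin_dim (N : set U) : Prop := exists n, has_dim N n.

(* [None] stands for an infinite dimension. *)
Definition dimension (N : set U) : option nat :=
  if pselect (fin_dim N) is left h then Some (projT1 (cid h)) else None.

Definition direct_sum (I : choiceType) (N : I -> set U) : Prop :=
  (forall i, subspace (N i)) /\
  forall u, exists! x : I -> U,
    [/\ finite_set [set i | x i != 0], (forall i, N i (x i))
      & u = \sum_(i \in [set: I]) x i].

Lemma span_subspace (X : set U) : subspace (span X).
Proof.
split=> [N [[N0 _] _] // | a u v Xu Xv N [Nsub XN]].
by apply: Nsub.2; [apply: Xu | apply: Xv].
Qed.

End LinearAlgebra.

Section Tensor.
Variables (K : comNzRingType) (V W : lmodType K).

Definition is_bilin (U : lmodType K) (B : V -> W -> U) : Prop :=
  (forall w, linear (B ^~ w)) /\ (forall v, linear (B v)).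

Definition bilin_sum (U : lmodType K) (B : V -> W -> U) (s : seq (V * W)) : U :=
  \sum_(p <- s) B p.1 p.2.

(* A list [(v_1, w_1); ...; (v_n, w_n)] stands for the sum of the v_i (x) w_i.
   Scalars are absorbed by the first factor.  Two lists denote the same tensor
   when no bilinear map separates them: this is the quotient of the free module
   on V * W by the bilinearity relations. *)
Definition tensor_eqv (s1 s2 : seq (V * W)) : bool :=
  `[< forall (U : lmodType K) (B : V -> W -> U),
        is_bilin B -> bilin_sum B s1 = bilin_sum B s2 >].

Lemma tensor_eqvP s1 s2 : reflect (forall (U : lmodType K) (B : V -> W -> U),
    is_bilin B -> bilin_sum B s1 = bilin_sum B s2) (tensor_eqv s1 s2).
Proof. exact: asboolP. Qed.

Lemma tensor_eqv_refl : reflexive tensor_eqv.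
Proof. by move=> s; apply/tensor_eqvP. Qed.

Lemma tensor_eqv_sym : symmetric tensor_eqv.
Proof.
by move=> s1 s2; apply/tensor_eqvP/tensor_eqvP => h U B hB; rewrite h.
Qed.

Lemma tensor_eqv_trans : transitive tensor_eqv.
Proof.
move=> s2 s1 s3 /tensor_eqvP h12 /tensor_eqvP h23; apply/tensor_eqvP=> U B hB.
by rewrite h12 // h23.
Qed.

Canonical tensor_eqv_equiv :=
  EquivRel tensor_eqv tensor_eqv_refl tensor_eqv_sym tensor_eqv_trans.

Definition tensor : Type := {eq_quot tensor_eqv}.
HB.instance Definition _ := Choice.on tensor.
HB.instance Definition _ := EqQuotient.on tensor.

Definition tpure (v : V) (w : W) : tensor := \pi_tensor [:: (v, w)].

Definition tlift (U : lmodType K) (B : V -> W -> U) (x : tensor) : U :=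
  bilin_sum B (repr x).

Definition tzero : tensor := \pi_tensor [::].
Definition tadd (x y : tensor) : tensor := \pi_tensor (repr x ++ repr y).
Definition tscale (a : K) (x : tensor) : tensor :=
  \pi_tensor [seq (a *: p.1, p.2) | p <- repr x].
Definition topp (x : tensor) : tensor := tscale (-1) x.

Lemma tensor_ext (x y : tensor) :
  (forall (U : lmodType K) (B : V -> W -> U), is_bilin B ->
     tlift B x = tlift B y) -> x = y.
Proof.
move=> h; rewrite -[x]reprK -[y]reprK; apply/eqmodP; apply/tensor_eqvP.
exact: h.
Qed.

Section Lift.
Variables (U : lmodType K) (B : V -> W -> U).
Hypothesis hB : is_bilin B.

Lemma tlift_pi s : tlift B (\pi_tensor s) = bilin_sum B s.
Proof.
rewrite /tlift; case: piP => s' /eqmodP/tensor_eqvP h.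
by rewrite (h _ _ hB).
Qed.

Lemma bilinZl a v w : B (a *: v) w = a *: B v w.
Proof.
have h0 : B 0 w = 0.
  have := hB.1 w (-1) 0 0; rewrite /= scaler0 addr0 => ->.
  by rewrite scaleN1r addNr.
by have := hB.1 w a v 0; rewrite /= addr0 h0 addr0.
Qed.

Lemma tlift_pure v w : tlift B (tpure v w) = B v w.
Proof. by rewrite tlift_pi /bilin_sum big_seq1. Qed.

Lemma tlift0 : tlift B tzero = 0.
Proof. by rewrite tlift_pi /bilin_sum big_nil. Qed.

Lemma tliftD x y : tlift B (tadd x y) = tlift B x + tlift B y.
Proof. by rewrite tlift_pi /bilin_sum big_cat. Qed.

Lemma tliftZ a x : tlift B (tscale a x) = a *: tlift B x.
Proof.
rewrite tlift_pi /bilin_sum big_map scaler_sumr.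
by apply: eq_bigr => p _ /=; rewrite bilinZl.
Qed.

Lemma tliftN x : tlift B (topp x) = - tlift B x.
Proof. by rewrite tliftZ scaleN1r. Qed.

End Lift.

Lemma taddA : associative tadd.
Proof. by move=> x y z; apply: tensor_ext => U B h; rewrite !tliftD // addrA. Qed.
Lemma taddC : commutative tadd.
Proof. by move=> x y; apply: tensor_ext => U B h; rewrite !tliftD // addrC. Qed.
Lemma tadd0 : left_id tzero tadd.
Proof. by move=> x; apply: tensor_ext => U B h; rewrite tliftD // tlift0 // add0r. Qed.
Lemma taddN : left_inverse tzero topp tadd.
Proof.
by move=> x; apply: tensor_ext => U B h; rewrite tliftD // tlift0 // tliftN // addNr.
Qed.

HB.instance Definition _ := GRing.isZmodule.Build tensor taddA taddC tadd0 taddN.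

Lemma tscaleA a b x : tscale a (tscale b x) = tscale (a * b) x.
Proof. by apply: tensor_ext => U B h; rewrite !tliftZ // scalerA. Qed.
Lemma tscale1 : left_id 1 tscale.
Proof. by move=> x; apply: tensor_ext => U B h; rewrite tliftZ // scale1r. Qed.
Lemma tscaleDr : right_distributive tscale +%R.
Proof.
by move=> a x y; apply: tensor_ext => U B h; rewrite !(tliftZ, tliftD) // scalerDr.
Qed.
Lemma tscaleDl x : {morph tscale^~ x : a b / a + b}.
Proof.
by move=> a b; apply: tensor_ext => U B h; rewrite !(tliftZ, tliftD) // scalerDl.
Qed.

HB.instance Definition _ := GRing.Zmodule_isLmodule.Build K tensor
  tscaleA tscale1 tscaleDr tscaleDl.

(* Universal property. *)
Lemma tlift_linear (U : lmodType K) (B : V -> W -> U) :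
  is_bilin B -> linear (tlift B).
Proof. by move=> h a x y; rewrite tliftD // tliftZ. Qed.

Lemma tpure_bilin : is_bilin tpure.
Proof.
split=> [w a v1 v2|v a w1 w2]; apply: tensor_ext => U B h;
  rewrite tlift_linear // !tlift_pure //.
- exact: h.1.
- exact: h.2.
Qed.

Lemma tensor_span (x : tensor) : x = tlift tpure x.
Proof.
apply: tensor_ext => U B h.
have B0 : tlift B 0 = 0 := tlift0 h.
have BD y z : tlift B (y + z) = tlift B y + tlift B z := tliftD h y z.
suff E s : tlift B (bilin_sum (@tpure) s) = bilin_sum B s by rewrite E.
elim: s => [|p s IHs]; first by rewrite /bilin_sum !big_nil B0.
by rewrite /bilin_sum !big_cons BD tlift_pure // -/(bilin_sum B s) -IHs.
Qed.

Lemma tlift_unique (U : lmodType K) (B : V -> W -> U) (f : tensor -> U) :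
  is_bilin B -> linear f -> (forall v w, f (tpure v w) = B v w) -> f =1 tlift B.
Proof.
move=> hB hf fB x; rewrite {1}[x]tensor_span /tlift /bilin_sum.
have f0 : f 0 = 0.
  have := hf (-1) 0 0; rewrite scaler0 addr0 => ->.
  by rewrite scaleN1r addNr.
elim: (repr x) => [|p s IHs]; first by rewrite !big_nil f0.
by rewrite !big_cons -[tpure _ _]scale1r hf scale1r fB IHs.
Qed.

End Tensor.

Section TensorMaps.
Variable K : comNzRingType.

Definition tmap (V1 V2 W1 W2 : lmodType K) (f : V1 -> W1) (g : V2 -> W2) :
    tensor V1 V2 -> tensor W1 W2 :=
  tlift (fun v w => tpure (f v) (g w)).

Definition tassoc (A B C : lmodType K) :
    tensor (tensor A B) C -> tensor A (tensor B C) :=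
  tlift (fun x c => tlift (fun a b => tpure a (tpure b c)) x).

(* tau (x) Id, read on right-bracketed triple tensor products *)
Definition tswap (A B C : lmodType K) :
    tensor A (tensor B C) -> tensor B (tensor A C) :=
  tlift (fun a y => tlift (fun b c => tpure b (tpure a c)) y).

End TensorMaps.

Section FormalSeries.
Variable R : realType.
Local Notation C := R[i].

Definition binc (x : C) (j : nat) : C := (\prod_(i < j) (x - i%:R)) / j`!%:R.

(* The coefficient of x^a y^b in (r x + s y)^n, expanded in nonnegative powers
   of y. *)
Definition expand (r s : C) (n a b : int) : C :=
  if (0 <= b) && (a + b == n) then r ^ a * s ^ b * binc n%:~R `|b|%N else 0.

(* The coefficient of z^l x^a y^b in z^-1 delta ((r x + s y) / (q z)). *)
Definition fdelta (q r s : C) (l a b : int) : C :=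
  let n := - l - 1 in q ^ (- n) * expand r s n a b.

(* A series in z0, z1, z2 is the function of its exponents.  The exponents of
   z0 and z1 are integers; those of z2 are integers or complex numbers. *)
Definition series3 (E U : Type) := int -> int -> E -> U.

Definition delta := series3 int C.
Definition delta_z0_z1Bz2 : delta :=       (* z0^-1 delta ((z1 - z2) / z0) *)
  fun a b c => fdelta 1 1 (-1) a b c.
Definition delta_Nz0_z2Bz1 : delta :=      (* z0^-1 delta ((z2 - z1) / (- z0)) *)
  fun a b c => fdelta (-1) 1 (-1) a c b.
Definition delta_z1_z2Dz0 : delta :=       (* z1^-1 delta ((z2 + z0) / z1) *)
  fun a b c => fdelta 1 1 1 b c a.
Definition delta_z0_Nz2Dz1 : delta :=      (* z0^-1 delta ((- z2 + z1) / z0) *)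
  fun a b c => fdelta 1 (-1) 1 a c b.
Definition delta_z2_z1Bz0 : delta :=       (* z2^-1 delta ((z1 - z0) / z2) *)
  fun a b c => fdelta 1 1 (-1) c b a.

(* The product of formal series.  [\sum_(x \in _)] is a sum over the support of
   the summand, and is 0 when that support is infinite; the truncation
   conditions below make every support finite. *)
Definition dmul (E : nzRingType) (U : lmodType C) (d : delta)
    (S : series3 E U) : series3 E U :=
  fun a b e => \sum_(x \in [set: int * int * int])
    d x.1.1 x.1.2 x.2 *: S (a - x.1.1) (b - x.1.2) (e - x.2%:~R).

(* Series that do not involve z0, respectively z1. *)
Definition in_z1z2 (E : Type) (U : lmodType C) (S : int -> E -> U) :
    series3 E U :=
  fun a b e => if a == 0 then S b e else 0.
Definition in_z0z2 (E : Type) (U : lmodType C) (S : int -> E -> U) :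
    series3 E U :=
  fun a b e => if b == 0 then S a e else 0.

(* [gen D] is the series \sum_k (D k) z^(- k - 1). *)
Definition gen (E : nzRingType) (U : Type) (D : E -> U) : E -> U :=
  fun e => D (- e - 1).

Definition ddz (E : nzRingType) (U : lmodType C) (toC : E -> C) (S : E -> U) :
    E -> U :=
  fun e => toC (e + 1) *: S (e + 1).

End FormalSeries.

Section Coalgebra.
Variable R : realType.
Local Notation C := R[i].

(* Jacobi identity for W : M3 -> M1 (x) M2 and the coactions of V on the M's. *)
Definition cojacobi (E : nzRingType) (V M1 M2 M3 : lmodType C)
    (D1 : int -> M1 -> tensor V M1) (D2 : int -> M2 -> tensor V M2)
    (D3 : int -> M3 -> tensor V M3) (W : E -> M3 -> tensor M1 M2) : Prop :=
  forall (m : M3) (a b : int) (e : E),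
    dmul (delta_z0_z1Bz2 R)
      (in_z1z2 (fun b e => tmap id (gen W e) (gen D3 b m))) a b e
    - dmul (delta_Nz0_z2Bz1 R)
      (in_z1z2 (fun b e => tswap (tmap id (gen D2 b) (gen W e m)))) a b e
    = dmul (delta_z1_z2Dz0 R)
      (in_z0z2 (fun a e => tassoc (tmap (gen D1 a) id (gen W e m)))) a b e.

Definition truncated (V M : lmodType C) (D : int -> M -> tensor V M) : Prop :=
  forall m, exists N : int, forall k, k < N -> D k m = 0.

Definition counital (V M : lmodType C) (co : V -> C^o)
    (D : int -> M -> tensor V M) : Prop :=
  forall m e, tlift (fun v m => co v *: m) (gen D e m) = if e == 0 then m else 0.

(* (rho (x) Id) Upsilon(z) = \sum_k L(k) z^(k - 2) *)
Definition Lmode (V M : lmodType C) (rho : V -> C^o)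
    (D : int -> M -> tensor V M) (k : int) : M -> M :=
  fun m => tlift (fun v m => rho v *: m) (gen D (k - 2) m).

Definition virasoro (M : lmodType C) (L : int -> M -> M) (d : C) : Prop :=
  forall k j m, L k (L j m) - L j (L k m) =
    (k - j)%:~R *: L (k + j) m +
    (if k + j == 0 then ((k ^+ 3 - k)%:~R / 12%:R * d) *: m else 0).

Definition L1_derivative (V M : lmodType C) (LV : V -> V) (LM : M -> M)
    (D : int -> M -> tensor V M) : Prop :=
  forall m e,
    tmap LV id (gen D e m) = ddz (fun x => x%:~R) (fun e => gen D e m) e /\
    tmap LV id (gen D e m) = gen D e (LM m) - tmap id LM (gen D e m).

(* The component of degree n of V (x) M; [deg i] is the degree of [gm i]. *)
Definition tensor_gr (V M : lmodType C) (I : Type) (deg : I -> int)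
    (gv : int -> set V) (gm : I -> set M) (n : int) : set (tensor V M) :=
  span [set x | exists a i v m,
          [/\ gv a v, gm i m, a + deg i = n & x = tpure v m]].

Record voc := Voc {
  voc_car :> lmodType C;
  voc_gr : int -> set voc_car;
  voc_D : int -> {linear voc_car -> tensor voc_car voc_car};
  voc_c : {linear voc_car -> C^o};
  voc_rho : {linear voc_car -> C^o};
  voc_rank : C;
  voc_gr_sum : direct_sum voc_gr;
  voc_gr_fin_dim : forall s, fin_dim (voc_gr s);
  voc_gr_bounded : exists N, forall s, s < N -> voc_gr s = [set 0];
  voc_truncated : truncated voc_D;
  voc_homogeneous : forall k s v, voc_gr s v ->
    tensor_gr id voc_gr voc_gr (s + k + 1) (voc_D k v);
  voc_counit_left : counital voc_c voc_D;
  voc_counit_right : forall v e, e <= 0 ->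
    tlift (fun v w => voc_c w *: v) (gen voc_D e v) = if e == 0 then v else 0;
  voc_jacobi : cojacobi voc_D voc_D voc_D voc_D;
  voc_virasoro : virasoro (Lmode voc_rho voc_D) voc_rank;
  voc_L0 : forall s v,
    voc_gr s v <-> Lmode voc_rho voc_D 0 v = s%:~R *: v;
  voc_L1 : L1_derivative (Lmode voc_rho voc_D 1) (Lmode voc_rho voc_D 1) voc_D
}.

Record comodule (V : voc) := Comodule {
  com_car :> lmodType C;
  com_gr : nat -> set com_car;
  com_D : int -> {linear com_car -> tensor V com_car};
  com_gr_sum : direct_sum com_gr;
  com_truncated : truncated com_D;
  com_counit : counital (@voc_c V) com_D;
  com_jacobi : cojacobi (@voc_D V) com_D com_D com_D;
  com_virasoro : virasoro (Lmode (@voc_rho V) com_D) (voc_rank V);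
  com_L1 : L1_derivative (Lmode (@voc_rho V) (@voc_D V) 1)
             (Lmode (@voc_rho V) com_D 1) com_D;
  com_homogeneous : forall k t m, com_gr t m ->
    tensor_gr Posz (@voc_gr V) com_gr (t%:Z + k + 1) (com_D k m)
}.

(* Graded subspaces N with Delta_k N in V (x) N. *)
Definition subcomodule (V M : lmodType C) (I : Type) (gm : I -> set M)
    (D : int -> M -> tensor V M) (N : set M) : Prop :=
  [/\ subspace N,
      N `<=` span [set m | N m /\ exists i, gm i m]
    & forall k m, N m -> span [set x | exists v n, N n /\ x = tpure v n] (D k m)].

Definition simple_subcomodule (V M : lmodType C) (I : Type) (gm : I -> set M)
    (D : int -> M -> tensor V M) (N : set M) : Prop :=
  subcomodule gm D N /\
  forall N', subcomodule gm D N' -> N' `<=` N -> N' = [set 0] \/ N' = N.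

Definition voc_simple (V : voc) : Prop :=
  simple_subcomodule (@voc_gr V) (@voc_D V) [set: V].

Definition cosemisimple (V : voc) (M : comodule V) : Prop :=
  exists (I : choiceType) (N : I -> set M),
    (forall i, simple_subcomodule (@com_gr V M) (@com_D V M) (N i)) /\
    direct_sum N.

Definition corational (V : voc) : Prop := forall M : comodule V, cosemisimple M.

Definition comodule_fin_dim (V : voc) (M : comodule V) : Prop :=
  forall t, fin_dim (com_gr (c := M) t).

Definition cointertwining (V : voc) (M1 M2 M3 : comodule V) :
    set (C -> M3 -> tensor M1 M2) :=
  [set W | [/\ forall t, linear (W t),
    forall m, exists r : R, forall t : C, complex.Re t < r -> W t m = 0,
    forall m e, ddz id (fun e => gen W e m) e =
      tmap (Lmode (@voc_rho V) (@com_D V M1) 1) id (gen W e m)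
    & cojacobi (@com_D V M1) (@com_D V M2) (@com_D V M3) W]].

Arguments cointertwining {V} M1 M2 M3.

(* N^{M1, M2}_{M3} *)
Definition co_fusion (V : voc) (M1 M2 M3 : comodule V) : option nat :=
  dimension (cointertwining M1 M2 M3).

End Coalgebra.

Section Modules.
Variable R : realType.
Local Notation C := R[i].

(* Underlying data of a vertex operator algebra and of a module over it: these
   are all that the definition of an intertwining operator refers to.  The
   coefficient of z^(- k - 1) in Y(a, z) is [voa_mode k a], [vm_mode k a]. *)
Record voa_data := VoaData {
  voa_car :> lmodType C;
  voa_mode : int -> voa_car -> voa_car -> voa_car;
  voa_vacuum : voa_car;
  voa_omega : voa_car
}.

Record vmod_data (A : voa_data) := VmodData {
  vm_car :> lmodType C;
  vm_mode : int -> A -> vm_car -> vm_car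
}.

(* Y(omega, z) = \sum_n L(n) z^(- n - 2) *)
Definition vm_L (A : voa_data) (N : vmod_data A) (n : int) : N -> N :=
  fun x => gen (fun k => vm_mode (v := N) k (voa_omega A)) (- n - 2) x.

Definition intertwining (A : voa_data) (N1 N2 N3 : vmod_data A) :
    set (C -> N1 -> N2 -> N3) :=
  [set Y | [/\ forall t, is_bilin (Y t),
    forall n1 n2 (l : C), exists T : int, forall t : int, T <= t ->
      Y (t%:~R + l) n1 n2 = 0,
    forall n1 n2 e, ddz id (fun e => gen Y e n1 n2) e =
      gen Y e (vm_L (-1) n1) n2
    & forall (v : A) (n1 : N1) (n2 : N2) (a b : int) (e : C),
      dmul (delta_z0_z1Bz2 R) (in_z1z2 (fun b e =>
        gen (@vm_mode _ N3) b v (gen Y e n1 n2))) a b e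
      - dmul (delta_z0_Nz2Dz1 R) (in_z1z2 (fun b e =>
        gen Y e n1 (gen (@vm_mode _ N2) b v n2))) a b e
      = dmul (delta_z2_z1Bz0 R) (in_z0z2 (fun a e =>
        gen Y e (gen (@vm_mode _ N1) a v n1) n2)) a b e]].
Arguments intertwining {A} N1 N2 N3.

(* N^{N3}_{N1, N2} *)
Definition fusion (A : voa_data) (N1 N2 N3 : vmod_data A) : option nat :=
  dimension (intertwining N1 N2 N3).

End Modules.

Section GradedDual.
Variable R : realType.
Local Notation C := R[i].

Section Carrier.
Variables (I : Type) (M : lmodType C) (gm : I -> set M).

(* The direct sum of the duals of the [gm i], inside the full dual of M: the
   linear forms that vanish on all but finitely many [gm i]. *)
Definition gdual_pred : {pred (M -> C^o)} :=
  fun f => `[< linear f /\ finite_set [set i | exists2 m, gm i m & f m != 0] >].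

Lemma gdual_submod_closed : submod_closed gdual_pred.
Proof.
have ev0 u : (0 : M -> C^o) u = 0 by [].
split.
  apply/asboolP; split; first by move=> b u v; rewrite !ev0 scaler0 addr0.
  by apply: (@sub_finite_set _ _ set0) => // i [m _]; rewrite ev0 eqxx.
have evD (a : C) (f g : M -> C^o) u : (a *: f + g) u = a *: f u + g u by [].
move=> a f g /asboolP[lf ff] /asboolP[lg fg]; apply/asboolP; split.
  move=> b u v; rewrite !evD lf lg !scalerDr !scalerA [a * b]mulrC.
  by rewrite -!addrA; congr (_ + _); rewrite addrCA.
apply: (@sub_finite_set _ _ ([set i | exists2 m, gm i m & f m != 0] `|`
    [set i | exists2 m, gm i m & g m != 0])); last by rewrite finite_setU.
move=> i [m gim]; rewrite !evD => h.
case: (eqVneq (f m) 0) => [fm0|]; last by left; exists m.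
by right; exists m => //; move: h; rewrite fm0 scaler0 add0r.
Qed.

HB.instance Definition _ :=
  GRing.isSubmodClosed.Build C (M -> C^o) gdual_pred gdual_submod_closed.

Record gdual := GDual { gform :> M -> C^o; _ : gform \in gdual_pred }.

HB.instance Definition _ := [isSub for gform].
HB.instance Definition _ := [Choice of gdual by <:].
HB.instance Definition _ := [SubChoice_isSubLmodule of gdual by <:].

Lemma gdual_linear (f : gdual) : linear f.
Proof. by case: f => f /= /asboolP[]. Qed.

Lemma gdual_finite (f : gdual) :
  finite_set [set i | exists2 m, gm i m & f m != 0].
Proof. by case: f => f /= /asboolP[]. Qed.

End Carrier.

Section Action.
Variables (V M : lmodType C) (I : Type) (deg : I -> int).
Variables (gv : int -> set V) (gm : I -> set M).
Variable D : int -> {linear M -> tensor V M}.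
Hypothesis deg_inj : injective deg.
Hypothesis homD : forall k t m, gm t m ->
  tensor_gr deg gv gm (deg t + k + 1) (D k m).

(* m |-> (f (x) x, D k m) *)
Definition gact_form (k : int) (f : gdual gv) (x : gdual gm) : M -> C^o :=
  fun m => tlift (fun v n => f v * x n : C^o) (D k m).

Lemma gact_bilin (f : gdual gv) (x : gdual gm) :
  is_bilin (fun v n => f v * x n : C^o).
Proof.
split=> [n a u v|v a u n]; rewrite gdual_linear.
  by rewrite mulrDl scalerAl.
by rewrite mulrDr scalerAr.
Qed.

Lemma gact_subproof k f x : gact_form k f x \in gdual_pred gm.
Proof.
apply/asboolP; split.
  move=> a u v; rewrite /gact_form linearP.
  by rewrite (tlift_linear (gact_bilin f x)).
pose A := [set (i + deg j - k - 1)%R | i in [set i | exists2 m, gv i m & f m != 0]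
  & j in [set i | exists2 m, gm i m & x m != 0]].
have finA : finite_set A by apply: finite_image2; apply: gdual_finite.
apply: (@sub_finite_set _ _ (deg @^-1` A)); last first.
  by apply: finite_preimage => // i j _ _; apply: deg_inj.
move=> t [m gtm]; apply: contraNP => At.
have := @homD k t m gtm; rewrite /gact_form; move: (D k m) => y hy.
pose B := (fun v n => f v * x n : C^o).
have lB := tlift_linear (gact_bilin f x).
have B0 : tlift B 0 = 0.
  have := lB (-1) 0 0; rewrite scaler0 addr0 => ->.
  by rewrite scaleN1r addNr.
apply/eqP; apply: (hy [set y | tlift B y = 0]); split=> /=.
  split=> [//|a u v /= hu hv].
  by rewrite lB -/B hu hv scaler0 addr0.
move=> _ [a [i [v [n [va ni e ->]]]]] /=.
rewrite tlift_pure; last exact: gact_bilin.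
apply/eqP; apply: contra_notT At; rewrite /B mulf_eq0 negb_or => /andP[fv xn].
exists a; first by exists v.
exists i; first by exists n.
by rewrite e [X in X - 1]addrAC !addrK.
Qed.

Definition gact k f x : gdual gm := GDual (gact_subproof k f x).

End Action.

Lemma homogeneous_in_gdual (M : lmodType C) (gm : int -> set M)
    (f : {linear M -> C^o}) (s : int) :
  (forall i m, gm i m -> i != s -> f m = 0) -> (f : M -> C^o) \in gdual_pred gm.
Proof.
move=> h; apply/asboolP; split; first by move=> a u v; rewrite linearP.
apply: (@sub_finite_set _ _ [set s]) => // i [m gim].
by apply: contraNP => /eqP is'; rewrite (h _ _ gim).
Qed.

Variable V : voc R.

(* rho lies in V_2^* *)
Definition rho_in_V2 : Prop := forall s v, voc_gr s v -> s != 2 -> voc_rho V v = 0.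

Lemma c_in_V0 s v : voc_gr s v -> s != 0 -> voc_c V v = 0.
Proof.
move=> /(@voc_L0 R V s v) hv s0.
pose B (u w : V) : C^o := voc_rho V u * voc_c V w.
have hB : is_bilin B.
  split=> [w a u1 u2|u a w1 w2]; rewrite /B linearP.
    by rewrite mulrDl scalerAl.
  by rewrite mulrDr scalerAr.
have hl : is_bilin (fun u w : V => voc_rho V u *: w).
  split=> [w a u1 u2|u a w1 w2]; first by rewrite linearP scalerDl scalerA.
  by rewrite scalerDr !scalerA mulrC.
have hr : is_bilin (fun u w : V => voc_c V w *: u).
  split=> [w a u1 u2|u a w1 w2]; last by rewrite linearP scalerDl scalerA.
  by rewrite scalerDr !scalerA mulrC.
have : voc_c V (Lmode (voc_rho V) (@voc_D R V) 0 v) = 0.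
  have := @voc_counit_right R V v (0 - 2) isT; rewrite /Lmode /gen /=.
  move: (voc_D _ _ _) => x hx.
  have -> : voc_c V (tlift (fun u w => voc_rho V u *: w) x) = tlift B x.
    apply: (tlift_unique hB (f := voc_c V \o tlift (fun u w => voc_rho V u *: w))).
      by move=> a y z; rewrite /= tlift_linear // linearP.
    by move=> u w; rewrite /= tlift_pure // linearZ.
  have <- : voc_rho V (tlift (fun u w => voc_c V w *: u) x) = tlift B x.
    apply: (tlift_unique hB (f := voc_rho V \o tlift (fun u w => voc_c V w *: u))).
      by move=> a y z; rewrite /= tlift_linear // linearP.
    by move=> u w; rewrite /= tlift_pure // linearZ /B mulrC.
  by rewrite hx linear0.
rewrite hv linearZ => /eqP; rewrite scaler_eq0 intr_eq0 (negPf s0) => /eqP //.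
Qed.

Definition dual_voa (hrho : rho_in_V2) : voa_data R := {|
  voa_car := gdual (@voc_gr R V);
  voa_mode := gact (@inj_id int) (@voc_homogeneous R V);
  voa_vacuum := GDual (homogeneous_in_gdual c_in_V0);
  voa_omega := GDual (homogeneous_in_gdual hrho)
|}.

Lemma Posz_injective : injective Posz.
Proof. by move=> i j []. Qed.

Definition dual_module (hrho : rho_in_V2) (M : comodule V) :
    vmod_data (dual_voa hrho) := {|
  vm_car := gdual (@com_gr R V M);
  vm_mode := (gact Posz_injective (@com_homogeneous R V M)
    : int -> dual_voa hrho -> _ -> _)
|}.

End GradedDual.

(* Main.v *)
Require Import Defs.
From mathcomp Require Import all_boot all_order all_algebra.
From mathcomp Require Import complex boolp classical_sets reals.
From mathcomp Require Import functions cardinality fsbigop finmap zify ring lra.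

(** A cointertwining operator W and an intertwining operator Y carry the same
    information when
      (f (x) g) (W_t m) = (Y_t f g) m
    for all t, all f, g in the graded duals of M^i, M^j and all m in M^k
    ([copairing], [pairing]).  Both sides are families of trilinear forms, and
    the Jacobi identity and the derivative property of W, tested against
    v (x) f (x) g, are those of Y evaluated at m, because the two Jacobi
    identities involve the same delta series ([delta_z0_Nz2Dz1E],
    [delta_z2_z1Bz0E]).  Linear forms may be moved inside the products of formal
    series since truncation makes these products finite sums.  Tensors are
    separated by tensor products of homogeneous forms ([tform_separates]), so
    nothing is lost in the passage to forms ([coef_cointertwining],
    [coef_intertwining]).

    What does not match formally is finiteness.  A given W might have, for fixed
    f and g, nonzero coefficients in infinitely many degrees of M^k, in which
    case Y_t f g would not lie in the graded dual; a given Y might need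
    infinitely many components of M^i (x) M^j to describe W_t m.  To control
    this, call t + 1 + n - p - q the weight of the coefficient of z^(- t - 1) on
    the components of degrees p, q, n ([weight]).  The Jacobi identity and the
    derivative property relate only coefficients of equal weight, so the part of
    a solution with weights in a given finite set is again a solution
    ([cut_jacobi], [cut_derivative]); for this part only finitely many pairs
    (p, q) occur for given t and n, and since the homogeneous components are
    finite-dimensional it is a genuine cointertwining operator, whether the
    solution came from a W or from a Y ([cut_exists], [cut_cointertwining]).
    Parts of distinct single weights are linearly independent.  The space of
    cointertwining operators having finite dimension, only finitely many weights
    occur ([finite_weights]), and then each side satisfies the finiteness
    conditions of the other ([cointertwining_to_intertwining],
    [intertwining_to_cointertwining]).  The resulting bijective linear relation
    preserves dimensions ([has_dim_transfer]). *)

Set Implicit Arguments.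
Unset Strict Implicit.
Unset Printing Implicit Defensive.
Import Order.TTheory GRing.Theory Num.Theory.
Local Open Scope classical_set_scope.
Local Open Scope ring_scope.

(** * Dimensions *)

Section Dimension.
Variable K : fieldType.

(** The matrices of coordinates of two bases in one another are inverse to each
    other, which forces them to be square. *)
Lemma has_dim_inj (U : lmodType K) (N : set U) n m :
  has_dim N n -> has_dim N m -> n = m.
Proof.
suff le : forall p q, has_dim N p -> has_dim N q -> (p <= q)%N.
  by move=> hn hm; apply/eqP; rewrite eqn_leq !le.
move=> p q [e [eN ecoord]] [f [fN fcoord]].
have /choice[A hA] : forall i, exists a : 'I_q -> K, e i = \sum_j a j *: f j.
  by move=> i; have [a [? _]] := fcoord _ (eN i); exists a.
have /choice[B hB] : forall j, exists b : 'I_p -> K, f j = \sum_i b i *: e i.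
  by move=> j; have [b [? _]] := ecoord _ (fN j); exists b.
have AB : (\matrix_(i, j) A i j) *m (\matrix_(j, i) B j i) = 1%:M.
  apply/matrixP => i k; rewrite !mxE.
  have [a [_ au]] := ecoord _ (eN i).
  have -> : (i == k)%:R = a k.
    rewrite (au (fun k => (i == k)%:R)) // (bigD1 i) //= eqxx scale1r.
    by rewrite big1 ?addr0 // => l /negPf; rewrite eq_sym => ->; rewrite scale0r.
  rewrite (au (fun k => \sum_j A i j * B j k)).
    by apply: eq_bigr => j _; rewrite !mxE.
  rewrite {1}hA; under eq_bigr => j _ do rewrite hB scaler_sumr.
  rewrite exchange_big /=; apply: eq_bigr => l _.
  by rewrite scaler_suml; apply: eq_bigr => j _; rewrite scalerA.
by have := mxrank1 K p; rewrite -AB => <-; rewrite mulmx_max_rank.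
Qed.

(** The coordinates of more than [n] vectors in a basis of length [n] form a
    matrix with a nonzero row kernel. *)
Lemma has_dim_dependent (U : lmodType K) (N : set U) n k (w : 'I_k -> U) :
  has_dim N n -> (n < k)%N -> (forall i, N (w i)) ->
  exists2 u : 'I_k -> K, (exists i, u i != 0) & \sum_i u i *: w i = 0.
Proof.
move=> [e [eN ecoord]] nk wN.
have /choice[A hA] : forall i, exists a : 'I_n -> K, w i = \sum_j a j *: e j.
  by move=> i; have [a [? _]] := ecoord _ (wN i); exists a.
pose M : 'M[K]_(k, n) := \matrix_(i, j) A i j.
have : kermx M != 0.
  by rewrite -mxrank_eq0 mxrank_ker -lt0n subn_gt0 (leq_ltn_trans (rank_leq_col _)).
case/rowV0Pn => u /sub_kermxP uM u0.
exists (u 0).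
  apply: contrapT => h; case/eqP: u0; apply/rowP => i; rewrite mxE.
  by apply/eqP/negbNE/negP => h'; apply: h; exists i.
under eq_bigr => i _ do rewrite hA scaler_sumr.
rewrite exchange_big /= big1 // => j _.
under eq_bigr => i _ do rewrite scalerA.
rewrite -scaler_suml.
have := congr1 (fun X : 'rV_n => X 0 j) uM; rewrite !mxE.
by under eq_bigr => i _ do rewrite mxE; move=> ->; rewrite scale0r.
Qed.

(** Stated for a relation between the ambient spaces, because the correspondence
    between operators is a map only on the subspaces that are compared. *)
Lemma has_dim_transfer (U U' : lmodType K) (rel : U -> U' -> Prop)
    (N : set U) (N' : set U') n :
  (forall a u v u' v', rel u u' -> rel v v' -> rel (a *: u + v) (a *: u' + v')) ->
  (forall u, rel u 0 -> u = 0) -> (forall u', rel 0 u' -> u' = 0) ->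
  (forall u, N u -> exists2 u', N' u' & rel u u') ->
  (forall u', N' u' -> exists2 u, N u & rel u u') ->
  has_dim N n -> has_dim N' n.
Proof.
move=> rlin rinj rfun rlr rrl [e [eN ecoord]].
(* [rel 0 0] comes from a difference of related pairs, hence needs a vector. *)
have r0 : rel 0 0 \/ n = 0%N.
  case: n e eN ecoord => [|n] e eN _; first by right.
  left; have [u' _ r] := rlr _ (eN ord0).
  by have := rlin (-1) _ _ _ _ r r; rewrite !scaleN1r !addNr.
have /choice[e' he'] : forall i, exists u', N' u' /\ rel (e i) u'.
  by move=> i; have [u' ? ?] := rlr _ (eN i); exists u'.
have rsum (a : 'I_n -> K) : n <> 0%N -> rel (\sum_i a i *: e i) (\sum_i a i *: e' i).
  move=> n0; case: r0 => // r0; elim/big_ind2: _ => //.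
  - by move=> u u' v v' h h'; have := rlin 1 _ _ _ _ h h'; rewrite !scale1r.
  - by move=> i _; have := rlin (a i) _ _ _ _ (he' i).2 r0; rewrite !addr0.
exists e'; split=> [i|u' N'u']; first by case: (he' i).
have [u Nu ru] := rrl _ N'u'; have [a [ha au]] := ecoord _ Nu.
have [n0|n0] := pselect (n = 0%N).
  subst n; move: ru; rewrite ha big_ord0 => /rfun ->.
  by exists a; split=> [|b _]; [rewrite big_ord0 | apply/funext; case].
exists a; split=> [|b hb].
  have := rlin (-1) _ _ _ _ (rsum a n0) ru; rewrite -ha !scaleN1r addNr => /rfun.
  by move/eqP; rewrite addrC subr_eq0 => /eqP.
apply: au; have := rlin (-1) _ _ _ _ (rsum b n0) ru.
rewrite -hb !scaleN1r addNr => /rinj.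
by move/eqP; rewrite addrC subr_eq0 => /eqP.
Qed.

Lemma has_dim_dimension (U : lmodType K) (N : set U) n :
  has_dim N n -> dimension N = Some n.
Proof.
move=> hn; rewrite /dimension; case: pselect => [h|[]]; last by exists n.
by case: (cid h) => m hm /=; rewrite (has_dim_inj hm hn).
Qed.

Lemma dimension_has_dim (U : lmodType K) (N : set U) :
  dimension N <> None -> exists n, has_dim N n.
Proof. by rewrite /dimension; case: pselect. Qed.

End Dimension.

(** * Separation of tensors by linear forms *)

Lemma linear_0 (K : comNzRingType) (U W : lmodType K) (f : U -> W) :
  linear f -> f 0 = 0.
Proof. by move=> lf; have := lf (-1) 0 0; rewrite !scaleN1r !addNr. Qed.

Lemma linear_D (K : comNzRingType) (U W : lmodType K) (f : U -> W) u v :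
  linear f -> f (u + v) = f u + f v.
Proof. by move=> lf; have := lf 1 u v; rewrite !scale1r. Qed.

Lemma linear_Z (K : comNzRingType) (U W : lmodType K) (f : U -> W) a u :
  linear f -> f (a *: u) = a *: f u.
Proof. by move=> lf; have := lf a u 0; rewrite (linear_0 lf) !addr0. Qed.

Lemma linear_bigsum (K : comNzRingType) (U W : lmodType K) (f : U -> W) (I : Type)
    (s : seq I) (P : pred I) (F : I -> U) : linear f ->
  f (\sum_(i <- s | P i) F i) = \sum_(i <- s | P i) f (F i).
Proof.
by move=> lf; apply: (big_morph f) => [u v|]; [apply: linear_D | apply: linear_0].
Qed.

Lemma tensor_linear_ext (K : comNzRingType) (A B U : lmodType K)
    (f g : tensor A B -> U) : linear f -> linear g ->
  (forall a b, f (tpure a b) = g (tpure a b)) -> f =1 g.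
Proof.
move=> lf lg fg x; rewrite [x]tensor_span /tlift /bilin_sum.
by rewrite !linear_bigsum //; apply: eq_bigr => p _.
Qed.

Section Separation.
Variable K : fieldType.

Definition separating (U : lmodType K) (F : set (U -> K^o)) :=
  (forall f, F f -> linear f) /\ forall u, (forall f, F f -> f u = 0) -> u = 0.

Variables A B : lmodType K.

Definition tform (al : A -> K^o) (be : B -> K^o) : tensor A B -> K^o :=
  tlift (fun a b => al a * be b : K^o).

Lemma tform_bilin (al : A -> K^o) (be : B -> K^o) : linear al -> linear be ->
  is_bilin (fun a b => al a * be b : K^o).
Proof.
move=> la lb; split=> [b c u v|a c u v]; rewrite /= (la, lb).
  by rewrite mulrDl scalerAl.
by rewrite mulrDr scalerAr.
Qed.

Lemma tform_linear (al : A -> K^o) (be : B -> K^o) :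
  linear al -> linear be -> linear (tform al be).
Proof. by move=> la lb; apply: tlift_linear; apply: tform_bilin. Qed.

Lemma tform_pure (al : A -> K^o) (be : B -> K^o) a b : linear al -> linear be ->
  tform al be (tpure a b) = al a * be b.
Proof. by move=> la lb; rewrite /tform tlift_pure //; apply: tform_bilin. Qed.

Lemma tpure_sub a a' b : tpure (a - a') b = tpure a b - tpure a' b :> tensor A B.
Proof.
have l := (tpure_bilin A B).1 b.
by rewrite -scaleN1r addrC l scaleN1r addrC.
Qed.

(** The forms of [FB] reduce the hypothesis to the vanishing of all contractions
    with a form of [FA].  If [al] does not vanish at the first factor of the
    leading term of a list of pure tensors, the contraction with [al] expresses
    its second factor through the others, and the list can be shortened. *)
Lemma tform_separates (FA : set (A -> K^o)) (FB : set (B -> K^o)) :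
  separating FA -> separating FB -> forall x,
  (forall al be, FA al -> FB be -> tform al be x = 0) -> x = 0.
Proof.
move=> [lA sA] [lB sB] x; rewrite [x]tensor_span /tlift /bilin_sum => h.
have {h} : forall al, FA al -> \sum_(p <- repr x) al p.1 *: p.2 = 0.
  move=> al Fal; apply: sB => be Fbe; rewrite -(h al be Fal Fbe).
  rewrite !linear_bigsum; [|exact: tform_linear (lA _ _) (lB _ _)|exact: lB].
  apply: eq_bigr => p _; rewrite tform_pure; [|exact: lA|exact: lB].
  by rewrite linear_Z //; apply: lB.
move: (repr x) => s; have [n] := ubnP (size s); elim: n s => // n IH [|[a b] s].
  by rewrite big_nil.
rewrite ltnS /= => sn h; rewrite big_cons /=.
have [a0|/eqP a0] := eqVneq a 0.
  rewrite a0 (linear_0 ((tpure_bilin A B).1 b)) add0r; apply: IH => // al Fal.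
  by have := h al Fal; rewrite big_cons /= a0 (linear_0 (lA _ Fal)) scale0r add0r.
have [al Fal ala] : exists2 al, FA al & al a != 0.
  apply: contrapT => nal; apply: a0; apply: sA => al Fal; apply/eqP/negbNE/negP.
  by move=> ala; apply: nal; exists al.
pose c p : K := (al a)^-1 * al p.
have eb : b = - \sum_(p <- s) c p.1 *: p.2.
  have := h al Fal; rewrite big_cons /= => /eqP; rewrite addr_eq0 => /eqP e.
  rewrite -[b](scalerK ala) e scalerN scaler_sumr; congr (- _).
  by apply: eq_bigr => p _; rewrite scalerA.
pose s' := [seq (p.1 - c p.1 *: a, p.2) | p <- s].
have -> : tpure a b + \sum_(p <- s) tpure p.1 p.2 = \sum_(p <- s') tpure p.1 p.2.
  rewrite {1}eb big_map /= [RHS](eq_bigr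
    (fun p => tpure p.1 p.2 - c p.1 *: tpure a p.2)).
    rewrite sumrB addrC; congr (_ + _).
    rewrite -scaleN1r (linear_Z _ _ ((tpure_bilin A B).2 a)) scaleN1r.
    rewrite (linear_bigsum _ _ _ ((tpure_bilin A B).2 a)); congr (- _).
    by apply: eq_bigr => p _; rewrite (linear_Z _ _ ((tpure_bilin A B).2 a)).
  by move=> p _; rewrite tpure_sub (linear_Z _ _ ((tpure_bilin A B).1 _)).
apply: IH => [|be Fbe]; first by rewrite size_map.
apply: etrans (h be Fbe); rewrite big_map big_cons /= [in X in X + _]eb.
rewrite scalerN scaler_sumr addrC -sumrB; apply: eq_bigr => p _.
have lb := lA _ Fbe; rewrite -scaleN1r addrC lb scaleN1r scalerDl scaleNr addrC.
by rewrite (linear_Z _ _ lb) scalerA mulrC.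
Qed.

Lemma tform_separating (FA : set (A -> K^o)) (FB : set (B -> K^o)) :
  separating FA -> separating FB ->
  separating [set ph | exists al be, [/\ FA al, FB be & ph = tform al be]].
Proof.
move=> sA sB; split=> [_ [al [be [Fal Fbe ->]]]|x h].
  by apply: tform_linear; [apply: sA.1 | apply: sB.1].
apply: (tform_separates sA sB) => al be Fal Fbe.
by apply: h; exists al, be.
Qed.

End Separation.

(** * Products of a delta series with a formal series *)

Lemma fsum_support (T : choiceType) (U : zmodType) (F : T -> U)
    (s : {fset T}) : [set x | F x != 0] `<=` [set` s] ->
  \sum_(x \in [set: T]) F x = \sum_(x <- s) F x.
Proof.
move=> Fs; apply: fsbigTE => x xs; apply/eqP; apply: contraNT xs => Fx.
exact: Fs.
Qed.

Lemma fsum_linear (K : comNzRingType) (T : choiceType) (U W : lmodType K)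
    (f : U -> W) (F : T -> U) : linear f -> finite_set [set x | F x != 0] ->
  f (\sum_(x \in [set: T]) F x) = \sum_(x \in [set: T]) f (F x).
Proof.
move=> lf /finite_fsetP[s Fs]; rewrite !(@fsum_support _ _ _ s) ?Fs //.
  by rewrite linear_bigsum.
rewrite -Fs => x /=; apply: contra_neq => ->; exact: linear_0.
Qed.

Lemma fsum_comb (K : comNzRingType) (T : choiceType) (U : lmodType K) (c : K)
    (F G : T -> U) :
  finite_set [set x | F x != 0] -> finite_set [set x | G x != 0] ->
  \sum_(x \in [set: T]) (c *: F x + G x) =
  c *: \sum_(x \in [set: T]) F x + \sum_(x \in [set: T]) G x.
Proof.
move=> fF fG; have /finite_fsetP[s Fs] : finite_set
    ([set x | F x != 0] `|` [set x | G x != 0]) by rewrite finite_setU.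
rewrite (@fsum_support _ _ F s) -?Fs; last by left.
rewrite (@fsum_support _ _ G s) -?Fs; last by right.
rewrite (@fsum_support _ _ _ s) -?Fs; first by rewrite big_split scaler_sumr.
move=> x /=; have [->|] := eqVneq (F x) 0; last by left.
by rewrite scaler0 add0r; right.
Qed.

Section DeltaProduct.
Variable R : realType.
Local Notation C := R[i].

(** The sum that defines [dmul] has a finite support: without this condition
    [dmul] takes a default value and is not additive. *)
Definition dfin (E : nzRingType) (U : lmodType C) (d : delta R)
    (S : series3 E U) (a b : int) (e : E) : Prop :=
  finite_set [set x : int * int * int |
    d x.1.1 x.1.2 x.2 *: S (a - x.1.1) (b - x.1.2) (e - x.2%:~R) != 0].

Lemma dmul_linear (E : nzRingType) (U W : lmodType C) (d : delta R)
    (S : series3 E U) (f : U -> W) a b e : linear f -> dfin d S a b e ->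
  f (dmul d S a b e) = dmul d (fun a b e => f (S a b e)) a b e.
Proof.
move=> lf fS; rewrite /dmul fsum_linear //; apply: eq_fsbigr => x _.
exact: linear_Z.
Qed.

Lemma dmul_comb (E : nzRingType) (U : lmodType C) (d : delta R) (c : C)
    (S T : series3 E U) a b e : dfin d S a b e -> dfin d T a b e ->
  dmul d (fun a b e => c *: S a b e + T a b e) a b e =
  c *: dmul d S a b e + dmul d T a b e.
Proof.
move=> fS fT; rewrite /dmul -fsum_comb //; apply: eq_fsbigr => x _.
by rewrite scalerDr !scalerA mulrC.
Qed.

(** The delta series of the Jacobi identities have this property.  It makes the
    total exponent of a product determine that of the series multiplied. *)
Definition degree_m1 (d : delta R) : Prop :=
  forall a b c, d a b c != 0 -> a + b + c = -1.

(** All terms of one coefficient of the product come from the same total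
    exponent of [S], so they are kept or dropped together. *)
Lemma dmul_cut (U : lmodType C) (d : delta R) (P : pred C) (S T : series3 C U)
    a b e : degree_m1 d ->
  (forall a b e, T a b e = if P (a%:~R + b%:~R + e) then S a b e else 0) ->
  dmul d T a b e = if P (a%:~R + b%:~R + e + 1) then dmul d S a b e else 0.
Proof.
move=> dd TS; rewrite /dmul.
have E x : d x.1.1 x.1.2 x.2 *: T (a - x.1.1) (b - x.1.2) (e - x.2%:~R) =
    if P (a%:~R + b%:~R + e + 1)
    then d x.1.1 x.1.2 x.2 *: S (a - x.1.1) (b - x.1.2) (e - x.2%:~R) else 0.
  have [->|/dd h] := eqVneq (d x.1.1 x.1.2 x.2) 0; first by rewrite !scale0r if_same.
  rewrite TS; have -> : (a - x.1.1)%:~R + (b - x.1.2)%:~R + (e - x.2%:~R) =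
      a%:~R + b%:~R + e + 1 :> C.
    have /(congr1 (fun k : int => k%:~R : C)) := h.
    rewrite !rmorphD !rmorphN /= => h'.
    transitivity (a%:~R + b%:~R + e - (x.1.1%:~R + x.1.2%:~R + x.2%:~R) : C).
      by ring.
    by rewrite h' mulr1z opprK.
  by case: ifP => _; rewrite ?scaler0.
under eq_fsbigr => x _ do rewrite E.
by case: ifP => // _; apply: fsbig1.
Qed.

Lemma int_interval_finite (lo hi : int) :
  finite_set [set k : int | lo <= k <= hi].
Proof.
apply: (@sub_finite_set _ _ [set lo + k%:Z | k in `I_(`|hi - lo|.+1)]).
  by move=> k /= h; exists `|k - lo|%N; lia.
by apply: finite_image; apply: finite_II.
Qed.

(** The total degree of [d] leaves a single free summation index [j], the
    exponent of z1; below it is that of z0. *)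
Lemma dfin_z1z2 (E : nzRingType) (U : lmodType C) (d : delta R)
    (S : int -> E -> U) a b e (lo hi : int) : degree_m1 d ->
  (forall j, d a j (-1 - a - j) != 0 -> S (b - j) (e - (-1 - a - j)%:~R) != 0 ->
     lo <= j <= hi) ->
  dfin d (in_z1z2 S) a b e.
Proof.
move=> dd h; apply: (@sub_finite_set _ _
  [set (a, j, -1 - a - j) | j in [set j | lo <= j <= hi]]); last first.
  by apply: finite_image; apply: int_interval_finite.
move=> [[x0 x1] x2] /=; rewrite scaler_eq0 negb_or /in_z1z2 => /andP[d0].
case: ifP => [/eqP ax|_]; last by rewrite eqxx.
have := dd _ _ _ d0 => dx S0.
have ex0 : x0 = a by lia.
have ex2 : x2 = -1 - a - x1 by lia.
by exists x1; [apply: h; rewrite -ex2 -?ex0|rewrite -ex2 -ex0].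
Qed.

Lemma dfin_z0z2 (E : nzRingType) (U : lmodType C) (d : delta R)
    (S : int -> E -> U) a b e (lo hi : int) : degree_m1 d ->
  (forall j, d j b (-1 - b - j) != 0 -> S (a - j) (e - (-1 - b - j)%:~R) != 0 ->
     lo <= j <= hi) ->
  dfin d (in_z0z2 S) a b e.
Proof.
move=> dd h; apply: (@sub_finite_set _ _
  [set (j, b, -1 - b - j) | j in [set j | lo <= j <= hi]]); last first.
  by apply: finite_image; apply: int_interval_finite.
move=> [[x0 x1] x2] /=; rewrite scaler_eq0 negb_or /in_z0z2 => /andP[d0].
case: ifP => [/eqP ax|_]; last by rewrite eqxx.
have := dd _ _ _ d0 => dx S0.
have ex1 : x1 = b by lia.
have ex2 : x2 = -1 - b - x0 by lia.
by exists x0; [apply: h; rewrite -ex2 -?ex1|rewrite -ex2 -ex1].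
Qed.

Lemma fdelta_support (q r s : C) l a b :
  fdelta q r s l a b != 0 -> 0 <= b /\ a + b = - l - 1.
Proof.
rewrite /fdelta /expand; case: ifP => [/andP[? /eqP ?] _ //|_].
by rewrite mulr0 eqxx.
Qed.

Lemma delta_z0_z1Bz2_support a b c :
  delta_z0_z1Bz2 R a b c != 0 -> 0 <= c /\ a + b + c = -1.
Proof. by move=> /fdelta_support; lia. Qed.

Lemma delta_Nz0_z2Bz1_support a b c :
  delta_Nz0_z2Bz1 R a b c != 0 -> 0 <= b /\ a + b + c = -1.
Proof. by move=> /fdelta_support; lia. Qed.

Lemma delta_z1_z2Dz0_support a b c :
  delta_z1_z2Dz0 R a b c != 0 -> 0 <= a /\ a + b + c = -1.
Proof. by move=> /fdelta_support; lia. Qed.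

Lemma signz_opp (k : int) : (-1) ^ (- k) = (-1) ^ k :> C.
Proof. by rewrite -exprz_inv invrN1. Qed.

Lemma fdelta_eq0 (q r s : C) l a b :
  ~~ ((0 <= b) && (a + b == - l - 1)) -> fdelta q r s l a b = 0.
Proof. by rewrite /fdelta /expand => /negPf ->; rewrite mulr0. Qed.

Lemma fdeltaE (q r s : C) l a b : 0 <= b -> a + b = - l - 1 ->
  fdelta q r s l a b = q ^ (- (a + b)) * (r ^ a * s ^ b * binc (a + b)%:~R `|b|).
Proof. by rewrite /fdelta /expand => -> <-; rewrite eqxx. Qed.

Lemma delta_z0_Nz2Dz1E : delta_z0_Nz2Dz1 R = delta_Nz0_z2Bz1 R.
Proof.
apply/funext => a; apply/funext => b; apply/funext => c.
rewrite /delta_z0_Nz2Dz1 /delta_Nz0_z2Bz1.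
have [/andP[b0 /eqP cb]|h] := boolP ((0 <= b) && (c + b == - a - 1)); last first.
  by rewrite !fdelta_eq0.
have n1 : (-1 : C) != 0 by rewrite oppr_eq0 oner_eq0.
rewrite !(fdeltaE _ _ _ b0 cb); move: (binc _ _) => y.
rewrite !exp1rz !mul1r mulr1 signz_opp (expfzDr _ _ n1) [RHS]mulrA; congr (_ * y).
by rewrite -mulrA -{2}[b]opprK signz_opp -(expfzDr _ _ n1) subrr expr0z mulr1.
Qed.

(** Reflection of the upper index, which compares the expansions of
    (z2 + z0)^n and (z1 - z0)^n' coefficient by coefficient. *)
Lemma binc_opp (x : C) j : binc (- x - 1) j = (-1) ^+ j * binc (x + j%:R) j.
Proof.
rewrite /binc mulrA; congr (_ / _).
rewrite [in RHS](reindex_inj rev_ord_inj) /=.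
rewrite -[X in (-1) ^+ X]card_ord -prodr_const -big_split /=.
by apply: eq_bigr => i _; rewrite natrB // -natr1; ring.
Qed.

Lemma delta_z2_z1Bz0E : delta_z2_z1Bz0 R = delta_z1_z2Dz0 R.
Proof.
apply/funext => a; apply/funext => b; apply/funext => c.
rewrite /delta_z2_z1Bz0 /delta_z1_z2Dz0.
have [/andP[a0 /eqP ba]|h] := boolP ((0 <= a) && (b + a == - c - 1)); last first.
  by rewrite !fdelta_eq0 //; apply: contraNN h; lia.
have ca : c + a = - b - 1 by lia.
rewrite (fdeltaE _ _ _ a0 ba) (fdeltaE _ _ _ a0 ca) !exp1rz !mul1r ca.
case: a a0 ba ca => [j|//] _ _ _.
by rewrite intrB mulrNz mulr1z binc_opp intrD.
Qed.

End DeltaProduct.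

(** * Graded spaces and their graded duals *)

Section Graded.
Variable R : realType.
Local Notation C := R[i].
Variables (M : lmodType C) (I : choiceType) (gm : I -> set M).
Hypothesis gm_sum : direct_sum gm.

Definition component (u : M) : I -> M := projT1 (cid (gm_sum.2 u)).

Lemma component_spec u : [/\ finite_set [set i | component u i != 0],
  forall i, gm i (component u i) & u = \sum_(i \in [set: I]) component u i].
Proof. by rewrite /component; case: cid => x [[]]. Qed.

Lemma component_unique u (x : I -> M) : finite_set [set i | x i != 0] ->
  (forall i, gm i (x i)) -> u = \sum_(i \in [set: I]) x i -> component u = x.
Proof. by move=> *; rewrite /component; case: cid => y [_] /=; apply. Qed.

Lemma gm0 i : gm i 0. Proof. by case: (gm_sum.1 i). Qed.

Lemma component_homogeneous i u :
  gm i u -> component u = fun j => if j == i then u else 0.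
Proof.
move=> gu; have si : [set j | (if j == i then u else 0) != 0] `<=` [set` [fset i]%fset].
  by move=> j /=; rewrite inE; case: ifP => //; rewrite eqxx.
apply: component_unique.
- by apply: sub_finite_set si (finite_fset _).
- by move=> j; case: eqP => [->|_]; [|apply: gm0].
- by rewrite (fsum_support si) big_seq_fset1 eqxx.
Qed.

Lemma component_linear i : linear (fun u => component u i).
Proof.
move=> a u v; suff -> : component (a *: u + v) =
    fun i => a *: component u i + component v i by [].
have [[fu gu su] [fv gv sv]] := (component_spec u, component_spec v).
apply: component_unique.
- apply: (@sub_finite_set _ _ ([set i | component u i != 0] `|` [set i | component v i != 0])).
    move=> j /=; have [->|] := eqVneq (component u j) 0; last by left.
    by rewrite scaler0 add0r; right.
  by rewrite finite_setU.
- by move=> j; apply: (gm_sum.1 j).2.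
- by rewrite fsum_comb // -su -sv.
Qed.

Lemma component_sum u : exists2 s : seq I, uniq s &
  (forall i, i \notin s -> component u i = 0) /\ u = \sum_(i <- s) component u i.
Proof.
have [/finite_fsetP[s fs] _ su] := component_spec u.
exists s; first exact: fset_uniq.
split=> [i|]; last by rewrite {1}su (@fsum_support _ _ _ s) ?fs.
apply: contraNeq => ui.
by have /= : [set` s] i by rewrite -fs.
Qed.

Lemma graded_eq0 (U : lmodType C) (f : M -> U) u : linear f ->
  (forall i, f (component u i) = 0) -> f u = 0.
Proof.
move=> lf f0; have [s _ [_ ->]] := component_sum u.
by rewrite (linear_bigsum _ _ _ lf) big1.
Qed.

Lemma graded_ext (U : lmodType C) (f g : M -> U) : linear f -> linear g ->
  (forall i m, gm i m -> f m = g m) -> f =1 g.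
Proof.
move=> lf lg fg u; apply/eqP; rewrite -subr_eq0; apply/eqP.
apply: (graded_eq0 (f := fun u => f u - g u)) => [a x y|i].
  by rewrite lf lg scalerBr opprD addrACA.
by have [_ gu _] := component_spec u; rewrite (fg _ _ (gu i)) subrr.
Qed.

Lemma graded_glue (U : lmodType C) (F : I -> M -> U) : (forall i, linear (F i)) ->
  exists G : M -> U, linear G /\ forall i m, gm i m -> G m = F i m.
Proof.
move=> lF; exists (fun m => \sum_(i \in [set: I]) F i (component m i)); split.
  have fin u : finite_set [set i | F i (component u i) != 0].
    have [fu _ _] := component_spec u; apply: sub_finite_set fu => i /=.
    by apply: contra_neq => ->; apply: linear_0.
  move=> a u v; rewrite -fsum_comb //; apply: eq_fsbigr => i _.
  by rewrite component_linear lF.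
move=> i m gim; rewrite (@fsum_support _ _ _ [fset i]%fset).
  by rewrite big_seq_fset1 (component_homogeneous gim) eqxx.
move=> j /=; rewrite inE (component_homogeneous gim).
by case: (j == i) => //; rewrite linear_0 ?eqxx.
Qed.

(** ** Homogeneous elements of the graded dual *)

Local Notation dual := (gdual gm).

Lemma gdual_ext (f g : dual) : (forall m, f m = g m) -> f = g.
Proof. by move=> fg; apply: val_inj; apply/funext. Qed.

Lemma gdualE (a : C) (f g : dual) m : (a *: f + g) m = a *: f m + g m.
Proof. by []. Qed.

Lemma gdual_ev_linear m : linear (fun f : dual => f m : C^o).
Proof. by move=> a f g. Qed.

Lemma gdual_sum (J : Type) (s : seq J) (F : J -> dual) m :
  (\sum_(j <- s) F j) m = \sum_(j <- s) F j m.
Proof. exact: (linear_bigsum s xpredT F (gdual_ev_linear m)). Qed.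

Variable deg : I -> int.
Hypothesis deg_inj : injective deg.

Definition homform (d : int) (f : dual) : Prop :=
  forall i m, gm i m -> deg i != d -> f m = 0.

Lemma homform_eq0 d f : homform d f -> (forall i, deg i != d) -> f = 0.
Proof.
move=> hf nd; apply: gdual_ext; apply: graded_ext => [||i m gim].
- exact: gdual_linear.
- by move=> a u v /=; rewrite scaler0 addr0.
- by rewrite (hf i m).
Qed.

(** Modes shift degrees by integers that may leave the set of degrees of [M];
    with integral degrees such vectors are just 0 and need no separate case. *)
Definition int_degree (d : int) : set M :=
  [set m | forall i, deg i != d -> component m i = 0].

Lemma int_degree_subspace d : subspace (int_degree d).
Proof.
split=> [i _|a u v hu hv i di]; first exact: linear_0 (component_linear i).
by rewrite component_linear hu // hv // scaler0 addr0.
Qed.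

Lemma gm_int_degree i m : gm i m -> int_degree (deg i) m.
Proof.
move=> gim j; rewrite (component_homogeneous gim).
by have [->|//] := eqVneq j i; rewrite eqxx.
Qed.

Lemma int_degree_ext (U : lmodType C) (f g : M -> U) d : linear f -> linear g ->
  (forall i m, deg i = d -> gm i m -> f m = g m) ->
  forall m, int_degree d m -> f m = g m.
Proof.
move=> lf lg fg m dm; apply/eqP; rewrite -subr_eq0; apply/eqP.
apply: (graded_eq0 (f := fun u => f u - g u)) => [a x y|i].
  by rewrite lf lg scalerBr opprD addrACA.
have [di|di] := eqVneq (deg i) d.
  by have [_ gu _] := component_spec m; rewrite (fg _ _ di (gu i)) subrr.
by rewrite dm // (linear_0 lf) (linear_0 lg) subrr.
Qed.

Lemma gdual_component_subproof (f : dual) i :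
  (fun u => f (component u i) : C^o) \in gdual_pred gm.
Proof.
apply/asboolP; split=> [a u v|]; first by rewrite component_linear gdual_linear.
apply: (@sub_finite_set _ _ [set i]) => [j [m gjm]|//].
rewrite (component_homogeneous gjm); have [->//|_] := eqVneq i j.
by rewrite (linear_0 (gdual_linear f)) eqxx.
Qed.

Definition gdual_component f i : dual := GDual (gdual_component_subproof f i).

Lemma homform_component f i : homform (deg i) (gdual_component f i).
Proof.
move=> j m gjm; rewrite (inj_eq deg_inj) => ji /=.
by rewrite (component_homogeneous gjm) eq_sym (negPf ji) (linear_0 (gdual_linear f)).
Qed.

Lemma gdual_component_sum f : exists s : seq I, f = \sum_(i <- s) gdual_component f i.
Proof.
have /finite_fsetP[s fs] := gdual_finite f.
exists s; apply: gdual_ext; apply: graded_ext => [||i m gim].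
- exact: gdual_linear.
- exact: gdual_linear.
- rewrite gdual_sum.
  under eq_bigr => j _ do rewrite /= (component_homogeneous gim).
  have [si|si] := boolP (i \in s).
    rewrite (bigD1_seq i) //= eqxx big1 ?addr0 // => j /negPf -> .
    exact: linear_0 (gdual_linear f).
  rewrite big_seq big1 => [|j js].
    apply/eqP; apply: contraNT si => fm.
    have : [set` s] i by rewrite -fs; exists m.
    by [].
  rewrite ifN ?(linear_0 (gdual_linear f)) //.
  by apply: contraNneq si => <-.
Qed.

Lemma gdual_linear_ext (U : lmodType C) (ph ps : dual -> U) :
  linear ph -> linear ps ->
  (forall i f, homform (deg i) f -> ph f = ps f) -> ph =1 ps.
Proof.
move=> lph lps e f; have [s ->] := gdual_component_sum f.
rewrite !linear_bigsum //; apply: eq_bigr => i _.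
by apply: e; apply: homform_component.
Qed.

Hypothesis gm_fin_dim : forall i, fin_dim (gm i).

(** The first entries of [s] form a basis of [gm i], the second entries its dual
    basis, extended by 0 to the other components. *)
Lemma dual_basis i : exists s : seq (M * dual),
  (forall x, x \in s -> gm i x.1 /\ homform (deg i) x.2) /\
  (forall u, gm i u -> u = \sum_(x <- s) x.2 u *: x.1).
Proof.
have [n [e [eg ecoord]]] := gm_fin_dim i.
have /choice[co hco] : forall u, exists a : 'I_n -> C, component u i = \sum_j a j *: e j.
  move=> u; have [_ gu _] := component_spec u.
  by have [a [? _]] := ecoord _ (gu i); exists a.
have co_unique u a : component u i = \sum_j a j *: e j -> co u = a.
  move=> ha; have [_ gu _] := component_spec u.
  have [b [_ bu]] := ecoord _ (gu i).
  by rewrite -(bu _ ha) (bu _ (hco u)).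
have co_lin j : linear (fun u => co u j : C^o).
  move=> a u v; rewrite (co_unique _ (fun j => a * co u j + co v j)) //.
  rewrite component_linear !hco scaler_sumr -big_split; apply: eq_bigr => k _ /=.
  by rewrite scalerDl scalerA.
have co_hom j k m : gm k m -> k != i -> co m j = 0.
  move=> gkm ki; rewrite (co_unique _ (fun=> 0)) //.
  rewrite (component_homogeneous gkm) eq_sym (negPf ki) big1 // => l _.
  by rewrite scale0r.
have co_in j : (fun u => co u j : C^o) \in gdual_pred gm.
  apply/asboolP; split=> //; apply: (@sub_finite_set _ _ [set i]) => // k [m gkm].
  by apply: contraNP => /eqP ki; rewrite (co_hom j k m).
exists [seq (e j, GDual (co_in j)) | j <- enum 'I_n]; split.
  move=> _ /mapP[j _ ->]; split=> //= k m gkm; rewrite (inj_eq deg_inj).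
  exact: co_hom.
move=> u gu; rewrite big_map big_enum /= -hco (component_homogeneous gu).
by rewrite eqxx.
Qed.

Lemma dual_basis_expand i (s : seq (M * dual)) f :
  (forall x, x \in s -> gm i x.1 /\ homform (deg i) x.2) ->
  (forall u, gm i u -> u = \sum_(x <- s) x.2 u *: x.1) ->
  homform (deg i) f -> f = \sum_(x <- s) f x.1 *: x.2.
Proof.
move=> sh su hf; apply: gdual_ext; apply: graded_ext => [||j m gjm].
- exact: gdual_linear.
- exact: gdual_linear.
- rewrite gdual_sum; have [ji|ji] := eqVneq j i.
    subst j; rewrite {1}(su _ gjm) (linear_bigsum _ _ _ (gdual_linear f)).
    apply: eq_bigr => x _; rewrite (linear_Z _ _ (gdual_linear f)).
    exact: mulrC.
  have dji : deg j != deg i by rewrite (inj_eq deg_inj).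
  rewrite (hf j) // big_seq big1 // => x /sh[_ hx].
  transitivity (f x.1 *: x.2 m); first by [].
  by rewrite (hx j) // scaler0.
Qed.

(** A nonzero vector has a nonzero component, on which some coordinate form does
    not vanish. *)
Lemma homform_separating :
  separating [set ph : M -> C^o | exists i f, homform (deg i) f /\ ph = gform f].
Proof.
split=> [_ [i [f [_ ->]]]|u h]; first exact: gdual_linear.
apply: (graded_eq0 (f := id)) => [//|i].
have [s [sh su]] := dual_basis i.
have [_ gu _] := component_spec u.
rewrite /= (su _ (gu i)) big_seq big1 // => x /sh[gx hx].
suff -> : x.2 (component u i) = 0 by rewrite scale0r.
transitivity (x.2 u); last by apply: h; exists i, x.2.
apply: (graded_ext (f := fun u => x.2 (component u i) : C^o)) => [a v w||j m gjm].
- by rewrite component_linear gdual_linear.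
- exact: gdual_linear.
- rewrite (component_homogeneous gjm); case: eqP => [//|/eqP ij].
  rewrite (linear_0 (gdual_linear _)) (hx j) //.
  by rewrite (inj_eq deg_inj) eq_sym.
Qed.

End Graded.

(** ** The action of the dual on the graded dual of a comodule *)

Section Action.
Variable R : realType.
Local Notation C := R[i].
Variables (V M : lmodType C) (I : choiceType) (deg : I -> int).
Variables (gv : int -> set V) (gm : I -> set M).
Variable D : int -> {linear M -> tensor V M}.
Hypothesis deg_inj : injective deg.
Hypothesis homD : forall k t m, gm t m ->
  tensor_gr deg gv gm (deg t + k + 1) (D k m).
Hypotheses (gv_sum : direct_sum gv) (gm_sum : direct_sum gm).

Definition contract (v : V -> C^o) : tensor V M -> M :=
  tlift (fun u m => v u *: m).

Lemma contract_bilin (v : V -> C^o) : linear v -> is_bilin (fun u (m : M) => v u *: m).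
Proof.
move=> lv; split=> [m a u w|u a m n]; first by rewrite lv scalerDl scalerA.
by rewrite scalerDr !scalerA mulrC.
Qed.

Lemma contract_linear (v : V -> C^o) : linear v -> linear (contract v).
Proof. by move=> lv; apply: tlift_linear; apply: contract_bilin. Qed.

Lemma contract_pure (v : V -> C^o) u m : linear v ->
  contract v (tpure u m) = v u *: m.
Proof. by move=> lv; rewrite /contract tlift_pure //; apply: contract_bilin. Qed.

Lemma contract_form (v : V -> C^o) (x : M -> C^o) y : linear v -> linear x ->
  x (contract v y) = tform v x y.
Proof.
move=> lv lx; apply: (tensor_linear_ext (f := x \o contract v)) => [a u w||u m] /=.
- by rewrite contract_linear // lx.
- exact: tform_linear.
- by rewrite contract_pure // tform_pure // linear_Z.
Qed.

Local Notation act := (gact deg_inj homD).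

(** The action of [v] on the dual is the transpose of a contracted coaction.
    This is what identifies the products of vertex operators on the two sides. *)
Lemma gactE k (v : gdual gv) (x : gdual gm) m :
  act k v x m = x (contract v (D k m)).
Proof. by rewrite contract_form //; apply: gdual_linear. Qed.

Lemma gact_linear_r k v : linear (act k v).
Proof. by move=> a x y; apply: gdual_ext => m; rewrite gdualE !gactE. Qed.

Lemma gact_linear_l k x : linear (fun v => act k v x).
Proof.
move=> a v w; apply: gdual_ext => m; rewrite gdualE !gactE.
have lx := gdual_linear x; have [lv lw] := (gdual_linear v, gdual_linear w).
have -> : contract (a *: v + w) (D k m) = a *: contract v (D k m) + contract w (D k m).
  move: (D k m); apply: tensor_linear_ext => [||u n].
  - exact: contract_linear (gdual_linear _).
  - move=> b y z; rewrite !contract_linear // !scalerDr !scalerA [b * a]mulrC.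
    exact: addrACA.
  - rewrite !contract_pure //; last exact: gdual_linear.
    by rewrite gdualE scalerDl scalerA.
by rewrite lx.
Qed.

Lemma contract_homogeneous k r (v : gdual gv) t m : homform id r v -> gm t m ->
  int_degree gm_sum deg (deg t + k + 1 - r) (contract v (D k m)).
Proof.
move=> hv gtm; have lv := gdual_linear v.
have [z0 zl] := int_degree_subspace gm_sum deg (deg t + k + 1 - r).
have := @homD k t m gtm; move: (D k m) => w hw.
apply: (hw [set y | int_degree gm_sum deg (deg t + k + 1 - r) (contract v y)]).
split=> /=.
  split=> [|a x y hx hy]; first by rewrite /= (linear_0 (contract_linear lv)).
  by rewrite /= contract_linear //; apply: zl.
move=> _ [a [i [u [n [ua ni ai ->]]]]]; rewrite /= contract_pure //.
have [ar|ar] := eqVneq a r; last by rewrite (hv a) // scale0r.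
rewrite -[_ *: n]addr0; apply: zl => //.
have -> : deg t + k + 1 - r = deg i by lia.
exact: gm_int_degree.
Qed.

Lemma homform_gact k r q v x : homform id r v -> homform deg q x ->
  homform deg (r + q - k - 1) (act k v x).
Proof.
move=> hv hx t m gtm dt; rewrite gactE.
transitivity (0 : C^o); last by [].
have lx := gdual_linear x.
have h := @contract_homogeneous k _ _ _ _ hv gtm.
apply: (int_degree_ext (f := gform x) (g := fun=> 0 : C^o) lx _ _ h).
  by move=> a u w; rewrite scaler0 addr0.
move=> i n di gin; apply: (hx i) => //.
by apply: contra dt => /eqP; lia.
Qed.

(** The degrees of the graded dual being bounded below, its modes of high index
    lower the degree too much to be nonzero. *)
Lemma gact_truncated v x : (forall i, 0 <= deg i) ->
  exists N : int, forall k, N <= k -> act k v x = 0.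
Proof.
move=> dpos.
have [sv ev] := gdual_component_sum gv_sum v; have [sx ex] := gdual_component_sum gm_sum x.
pose N : int := \sum_(r <- sv) `|r| + \sum_(i <- sx) `|deg i|.
exists N => k Nk; rewrite ev.
rewrite (linear_bigsum _ _ _ (gact_linear_l k x)) big_seq big1 // => r rs.
rewrite ex (linear_bigsum _ _ _ (gact_linear_r k _)) big_seq big1 // => i si.
have hv : homform id r (gdual_component gv_sum v r) by apply: homform_component.
have hx : homform deg (deg i) (gdual_component gm_sum x i) by apply: homform_component.
have h := @homform_gact k _ _ _ _ hv hx.
apply: (homform_eq0 gm_sum h) => j.
have hr : `|r| <= \sum_(r <- sv) `|r|.
  by rewrite (big_rem r) //= lerDl sumr_ge0.
have hi : `|deg i| <= \sum_(i <- sx) `|deg i|.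
  by rewrite (big_rem i) //= lerDl sumr_ge0.
have := dpos j; rewrite /N in Nk; move: Nk hr hi.
move: (\sum_(r <- sv) _) (\sum_(i <- sx) _) => X Y; lia.
Qed.

End Action.

(** * Pairing the tensor maps with linear forms *)

Section TensorMapPairing.
Variable R : realType.
Local Notation C := R[i].

Lemma tmap_bilin (A B A' B' : lmodType C) (f : A -> A') (g : B -> B') :
  linear f -> linear g -> is_bilin (fun a b => tpure (f a) (g b)).
Proof.
move=> lf lg; split=> [b c u v|a c u v] /=.
  by rewrite lf (tpure_bilin A' B').1.
by rewrite lg (tpure_bilin A' B').2.
Qed.

Lemma tmap_linear (A B A' B' : lmodType C) (f : A -> A') (g : B -> B') :
  linear f -> linear g -> linear (tmap f g).
Proof. by move=> lf lg; apply: tlift_linear; apply: tmap_bilin. Qed.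

Lemma tmap_pure (A B A' B' : lmodType C) (f : A -> A') (g : B -> B') a b :
  linear f -> linear g -> tmap f g (tpure a b) = tpure (f a) (g b).
Proof. by move=> lf lg; rewrite /tmap tlift_pure //; apply: tmap_bilin. Qed.

Lemma tswap_inner_bilin (A B D : lmodType C) (a : A) :
  is_bilin (fun (b : B) (c : D) => tpure b (tpure a c)).
Proof.
have [_ h2] := tpure_bilin A D; have [h3 h4] := tpure_bilin B (tensor A D).
by split=> [c k u v|b k u v] /=; rewrite ?h2 ?h4 ?h3.
Qed.

Lemma tswap_bilin (A B D : lmodType C) : is_bilin (fun (a : A) (y : tensor B D) =>
  tlift (fun b c => tpure b (tpure a c)) y).
Proof.
have hb := @tswap_inner_bilin A B D.
split=> [x k u v|u]; last exact: tlift_linear.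
move: x; apply: tensor_linear_ext => [|k' x z|b c].
- exact: tlift_linear.
- by rewrite !(tlift_linear (hb _)) !scalerDr !scalerA [k * _]mulrC addrACA.
- by rewrite !tlift_pure // (tpure_bilin A D).1 (tpure_bilin B _).2.
Qed.

Lemma tassoc_inner_bilin (A B D : lmodType C) (c : D) :
  is_bilin (fun (a : A) (b : B) => tpure a (tpure b c)).
Proof.
have [h1 _] := tpure_bilin B D; have [h3 h4] := tpure_bilin A (tensor B D).
by split=> [b k u v|a k u v] /=; rewrite ?h1 ?h4 ?h3.
Qed.

Lemma tassoc_bilin (A B D : lmodType C) : is_bilin (fun (x : tensor A B) (c : D) =>
  tlift (fun a b => tpure a (tpure b c)) x).
Proof.
have hb := @tassoc_inner_bilin A B D.
split=> [u|x k u v]; first exact: tlift_linear.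
move: x; apply: tensor_linear_ext => [|k' x z|a b].
- exact: tlift_linear.
- by rewrite !(tlift_linear (hb _)) !scalerDr !scalerA [k * _]mulrC addrACA.
- by rewrite !tlift_pure // (tpure_bilin B D).2 (tpure_bilin A _).2.
Qed.

Lemma tswap_linear (A B D : lmodType C) : linear (@tswap C A B D).
Proof. exact: tlift_linear (tswap_bilin A B D). Qed.

Lemma tassoc_linear (A B D : lmodType C) : linear (@tassoc C A B D).
Proof. exact: tlift_linear (tassoc_bilin A B D). Qed.

Lemma tform_tmap_id (A B B' : lmodType C) (v : A -> C^o) (h : B' -> C^o)
    (f : B -> B') y : linear v -> linear h -> linear f ->
  tform v h (tmap id f y) = h (f (contract v y)).
Proof.
move=> lv lh lf; move: y; apply: tensor_linear_ext => [k x y|k x y|a b].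
- by rewrite tmap_linear // tform_linear.
- by rewrite contract_linear // lf lh.
- by rewrite tmap_pure // tform_pure // contract_pure // !linear_Z.
Qed.

Lemma tform_tmap_l (A A' B : lmodType C) (f : A' -> C^o) (g : B -> C^o)
    (h : A -> A') x : linear f -> linear g -> linear h ->
  tform f g (tmap h id x) = tform (f \o h) g x.
Proof.
move=> lf lg lh; have lfh : linear (f \o h) by move=> k u v /=; rewrite lh lf.
move: x; apply: tensor_linear_ext => [k x y|k x y|a b].
- by rewrite tmap_linear // tform_linear.
- by rewrite tform_linear.
- by rewrite tmap_pure // !tform_pure.
Qed.

Lemma tform_tswap (A B D M : lmodType C) (v : B -> C^o) (f : A -> C^o)
    (g : D -> C^o) (h : M -> tensor B D) x :
  linear v -> linear f -> linear g -> linear h ->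
  tform v (tform f g) (tswap (tmap id h x)) = tform f (tform v g \o h) x.
Proof.
move=> lv lf lg lh; have lfg := tform_linear lf lg.
have lvg := tform_linear lv lg; have lt := tform_linear lv lfg.
have lvgh : linear (tform v g \o h) by move=> k u w /=; rewrite lh lvg.
move: x; apply: tensor_linear_ext => [k x y|k x y|a m].
- by rewrite tmap_linear // tswap_linear lt.
- by rewrite tform_linear.
rewrite tmap_pure // tform_pure //= /tswap tlift_pure; last exact: tswap_bilin.
move: (h m); apply: tensor_linear_ext => [k x y|k x y|b d].
- by rewrite (tlift_linear (tswap_inner_bilin B D a)) lt.
- by rewrite lvg mulrDr scalerAr.
- rewrite tlift_pure ?tform_pure //; last exact: tswap_inner_bilin.
  exact: mulrCA.
Qed.

Lemma tform_tassoc (A B D M : lmodType C) (v : A -> C^o) (f : B -> C^o)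
    (g : D -> C^o) (h : M -> tensor A B) x :
  linear v -> linear f -> linear g -> linear h ->
  tform v (tform f g) (tassoc (tmap h id x)) = tform (tform v f \o h) g x.
Proof.
move=> lv lf lg lh; have lfg := tform_linear lf lg.
have lvf := tform_linear lv lf; have lt := tform_linear lv lfg.
have lvfh : linear (tform v f \o h) by move=> k u w /=; rewrite lh lvf.
move: x; apply: tensor_linear_ext => [k x y|k x y|m d].
- by rewrite tmap_linear // tassoc_linear lt.
- by rewrite tform_linear.
rewrite tmap_pure // tform_pure //= /tassoc tlift_pure; last exact: tassoc_bilin.
move: (h m); apply: tensor_linear_ext => [k x y|k x y|a b].
- by rewrite (tlift_linear (tassoc_inner_bilin A B d)) lt.
- by rewrite lvf mulrDl scalerAl.
- rewrite tlift_pure ?tform_pure //; last exact: tassoc_inner_bilin.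
  exact: mulrA.
Qed.

End TensorMapPairing.

(** * Matrix coefficients of (co)intertwining operators *)

Section RealPart.
Variable R : realType.
Implicit Types x y : R[i].

Lemma Re_D x y : complex.Re (x + y) = complex.Re x + complex.Re y.
Proof. by case: x y => [? ?] [? ?]. Qed.
Lemma Re_N x : complex.Re (- x) = - complex.Re x.
Proof. by case: x. Qed.
Lemma Re_int (k : int) : complex.Re (k%:~R : R[i]) = k%:~R.
Proof. by rewrite -(rmorph_int (real_complex R)). Qed.
Lemma Re_1 : complex.Re (1 : R[i]) = 1.
Proof. by []. Qed.

End RealPart.

Section Coefficients.
Variables (R : realType) (V : voc R) (hrho : rho_in_V2 V) (M1 M2 M3 : comodule V).
Local Notation C := R[i].
Local Notation V' := (gdual (@voc_gr R V)).
Local Notation X1 := (gdual (@com_gr R V M1)).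
Local Notation X2 := (gdual (@com_gr R V M2)).
Local Notation X3 := (gdual (@com_gr R V M3)).
Local Notation act M := (gact Posz_injective (@com_homogeneous R V M)).
Local Notation series := (C -> X1 -> X2 -> M3 -> C^o).
Local Notation omega := (GDual (homogeneous_in_gdual hrho)).
Local Notation gr_sum := (@com_gr_sum R V).

(** The entries of the three products of the Jacobi identity, with the vertex
    operator of [v] acting on [M1], [M2] and [M3] respectively.  They are written
    for an arbitrary family of trilinear forms so that both kinds of operators
    can be compared with them. *)
Definition coef_on1 (ka : series) (v : V') f g m : int -> C -> C^o :=
  fun a e => gen ka e (gen (act M1) a v f) g m.
Definition coef_on2 (ka : series) (v : V') f g m : int -> C -> C^o :=
  fun b e => gen ka e f (gen (act M2) b v g) m.
Definition coef_on3 (ka : series) (v : V') f g m : int -> C -> C^o :=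
  fun b e => gen ka e f g (contract v (gen (@com_D R V M3) b m)).

Definition coef_jacobi (ka : series) v f g m (a b : int) (e : C) : C^o :=
  dmul (delta_z0_z1Bz2 R) (in_z1z2 (coef_on3 ka v f g m)) a b e
  - dmul (delta_Nz0_z2Bz1 R) (in_z1z2 (coef_on2 ka v f g m)) a b e
  - dmul (delta_z1_z2Dz0 R) (in_z0z2 (coef_on1 ka v f g m)) a b e.

Definition coef_derivative (ka : series) f g m : Prop :=
  forall e, (e + 1) *: gen ka (e + 1) f g m = gen ka e (act M1 0 omega f) g m.

Definition trilinear (ka : series) : Prop :=
  [/\ forall t f g, linear (ka t f g), forall t f m, linear (fun g => ka t f g m)
    & forall t g m, linear (fun f => ka t f g m)].

Definition is_coef (ka : series) : Prop :=
  [/\ trilinear ka, forall f g m, coef_derivative ka f g m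
    & forall v f g m a b e, coef_jacobi ka v f g m a b e = 0].

Lemma degree_z0_z1Bz2 : degree_m1 (delta_z0_z1Bz2 R).
Proof. by move=> a b c /delta_z0_z1Bz2_support[]. Qed.
Lemma degree_Nz0_z2Bz1 : degree_m1 (delta_Nz0_z2Bz1 R).
Proof. by move=> a b c /delta_Nz0_z2Bz1_support[]. Qed.
Lemma degree_z1_z2Dz0 : degree_m1 (delta_z1_z2Dz0 R).
Proof. by move=> a b c /delta_z1_z2Dz0_support[]. Qed.

Lemma in_z1z2_linear (E : Type) (U W : lmodType C) (ph : U -> W)
    (S : int -> E -> U) : linear ph ->
  (fun a b e => ph (in_z1z2 S a b e)) = in_z1z2 (fun b e => ph (S b e)).
Proof.
move=> lph; apply/funext => a; apply/funext => b; apply/funext => e.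
by rewrite /in_z1z2; case: ifP => // _; rewrite linear_0.
Qed.

Lemma in_z0z2_linear (E : Type) (U W : lmodType C) (ph : U -> W)
    (S : int -> E -> U) : linear ph ->
  (fun a b e => ph (in_z0z2 S a b e)) = in_z0z2 (fun b e => ph (S b e)).
Proof.
move=> lph; apply/funext => a; apply/funext => b; apply/funext => e.
by rewrite /in_z0z2; case: ifP => // _; rewrite linear_0.
Qed.

Lemma tform_gdual_linear_r (f : X1) (x : tensor M1 M2) :
  linear (fun g : X2 => tform f g x).
Proof.
move=> a g h; have [lf lg lh] := And3 (gdual_linear f) (gdual_linear g) (gdual_linear h).
have lgh : linear (a *: g + h : X2) by apply: gdual_linear.
move: x; apply: tensor_linear_ext => [|b x y|u w].
- exact: tform_linear.
- by rewrite !tform_linear // !scalerDr !scalerA [b * a]mulrC addrACA.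
- by rewrite !tform_pure // gdualE mulrDr scalerAr.
Qed.

Lemma tform_gdual_linear_l (g : X2) (x : tensor M1 M2) :
  linear (fun f : X1 => tform f g x).
Proof.
move=> a f h; have [lf lg lh] := And3 (gdual_linear f) (gdual_linear g) (gdual_linear h).
have lfh : linear (a *: f + h : X1) by apply: gdual_linear.
move: x; apply: tensor_linear_ext => [|b x y|u w].
- exact: tform_linear.
- by rewrite !tform_linear // !scalerDr !scalerA [b * a]mulrC addrACA.
- by rewrite !tform_pure // gdualE mulrDl scalerAl.
Qed.

(** ** The cointertwining side *)

Section Cointertwining.
Variable W : C -> M3 -> tensor M1 M2.
Hypothesis W_linear : forall t, linear (W t).

Definition copairing : series := fun t f g m => tform f g (W t m).

Lemma copairing_trilinear : trilinear copairing.
Proof.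
split=> [t f g|t f m|t g m].
- by move=> a u v; rewrite /copairing W_linear tform_linear //; apply: gdual_linear.
- exact: tform_gdual_linear_r.
- exact: tform_gdual_linear_l.
Qed.

Definition cojac1 m : int -> C -> tensor V (tensor M1 M2) :=
  fun a e => tassoc (tmap (gen (@com_D R V M1) a) id (gen W e m)).
Definition cojac2 m : int -> C -> tensor V (tensor M1 M2) :=
  fun b e => tswap (tmap id (gen (@com_D R V M2) b) (gen W e m)).
Definition cojac3 m : int -> C -> tensor V (tensor M1 M2) :=
  fun b e => tmap id (gen W e) (gen (@com_D R V M3) b m).

Definition cojac m (a b : int) (e : C) : tensor V (tensor M1 M2) :=
  dmul (delta_z0_z1Bz2 R) (in_z1z2 (cojac3 m)) a b e
  - dmul (delta_Nz0_z2Bz1 R) (in_z1z2 (cojac2 m)) a b e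
  - dmul (delta_z1_z2Dz0 R) (in_z0z2 (cojac1 m)) a b e.

Hypothesis W_truncated : forall m, exists r : R,
  forall t : C, complex.Re t < r -> W t m = 0.

Lemma gen_linear (M : comodule V) k : linear (gen (@com_D R V M) k).
Proof. by move=> a u v; rewrite /gen linearP. Qed.

Lemma W_gen_linear e : linear (gen W e).
Proof. exact: W_linear. Qed.

Lemma W_truncated_int m (e : C) : exists N : int, forall j : int, N < j ->
  gen W (e + j%:~R) m = 0.
Proof.
have [r hr] := W_truncated m; pose x := - r - complex.Re e - 1.
exists (Num.bound `|x|)%:Z => j Nj; apply: hr.
rewrite !(Re_D, Re_N) Re_int Re_1.
have := archi_boundP (normr_ge0 x); have := ler_norm x.
have : (Num.bound `|x|)%:~R < j%:~R :> R by rewrite ltr_int.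
rewrite /x -pmulrn; lra.
Qed.

(** Along each of the three expansions the index of the coaction on [M3] (first
    product) or of [W] (other two) decreases, and truncation ends the sum. *)
Lemma cojac3_fin m a b e : dfin (delta_z0_z1Bz2 R) (in_z1z2 (cojac3 m)) a b e.
Proof.
have [N hN] := com_truncated m.
apply: (dfin_z1z2 (lo := b + N) (hi := -1 - a) degree_z0_z1Bz2) => j.
move=> /delta_z0_z1Bz2_support[j0 _] S0; apply/andP; split; last by lia.
rewrite leNgt; apply: contraNN S0 => jN.
rewrite /cojac3 {2}/gen hN ?(linear_0 (tmap_linear _ _)) //.
- exact: W_gen_linear.
- by move: jN; lia.
Qed.

Lemma cojac2_fin m a b e : dfin (delta_Nz0_z2Bz1 R) (in_z1z2 (cojac2 m)) a b e.
Proof.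
have [N hN] := W_truncated_int m (e + 1 + a%:~R).
apply: (dfin_z1z2 (lo := 0) (hi := N) degree_Nz0_z2Bz1) => j.
move=> /delta_Nz0_z2Bz1_support[j0 _] S0; rewrite j0 /= leNgt.
apply: contraNN S0 => jN.
have -> : e - (-1 - a - j)%:~R = e + 1 + a%:~R + j%:~R :> C.
  by rewrite !(intrB, intrN); ring.
rewrite /cojac2 hN // (linear_0 (tmap_linear _ (gen_linear _))) //.
by rewrite (linear_0 (@tswap_linear _ _ _ _)).
Qed.

Lemma cojac1_fin m a b e : dfin (delta_z1_z2Dz0 R) (in_z0z2 (cojac1 m)) a b e.
Proof.
have [N hN] := W_truncated_int m (e + 1 + b%:~R).
apply: (dfin_z0z2 (lo := 0) (hi := N) degree_z1_z2Dz0) => j.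
move=> /delta_z1_z2Dz0_support[j0 _] S0; rewrite j0 /= leNgt.
apply: contraNN S0 => jN.
have -> : e - (-1 - b - j)%:~R = e + 1 + b%:~R + j%:~R :> C.
  by rewrite !(intrB, intrN); ring.
rewrite /cojac1 hN // (linear_0 (tmap_linear (gen_linear _) _)) //.
by rewrite (linear_0 (@tassoc_linear _ _ _ _)).
Qed.

Lemma cojac_copairing (v : V') (f : X1) (g : X2) m a b e :
  tform v (tform f g) (cojac m a b e) = coef_jacobi copairing v f g m a b e.
Proof.
have [lv lf lg] := And3 (gdual_linear v) (gdual_linear f) (gdual_linear g).
have lfg := tform_linear lf lg; have lt := tform_linear lv lfg.
have sub x y : tform v (tform f g) (x - y) =
    tform v (tform f g) x - tform v (tform f g) y.
  by rewrite -scaleN1r addrC lt scaleN1r addrC.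
rewrite /cojac /coef_jacobi !sub.
rewrite (dmul_linear lt (cojac3_fin _ _ _ _)) (dmul_linear lt (cojac2_fin _ _ _ _)).
rewrite (dmul_linear lt (cojac1_fin _ _ _ _)) !in_z1z2_linear // in_z0z2_linear //.
congr (dmul _ (in_z1z2 _) a b e - dmul _ (in_z1z2 _) a b e
       - dmul _ (in_z0z2 _) a b e).
- apply/funext => b'; apply/funext => e'; rewrite /cojac3 tform_tmap_id //.
  exact: W_gen_linear.
- apply/funext => b'; apply/funext => e'; rewrite /cojac2 tform_tswap //.
  exact: gen_linear.
- apply/funext => b'; apply/funext => e'; rewrite /cojac1 tform_tassoc //.
  exact: gen_linear.
Qed.

Lemma cojac_linear a b e : linear (fun m => cojac m a b e).
Proof.
move=> k m n.
have e3 : in_z1z2 (cojac3 (k *: m + n)) =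
    fun a b e => k *: in_z1z2 (cojac3 m) a b e + in_z1z2 (cojac3 n) a b e.
  apply/funext => a'; apply/funext => b'; apply/funext => e'; rewrite /in_z1z2.
  case: ifP => _; last by rewrite scaler0 addr0.
  by rewrite /cojac3 gen_linear tmap_linear //; apply: W_gen_linear.
have e2 : in_z1z2 (cojac2 (k *: m + n)) =
    fun a b e => k *: in_z1z2 (cojac2 m) a b e + in_z1z2 (cojac2 n) a b e.
  apply/funext => a'; apply/funext => b'; apply/funext => e'; rewrite /in_z1z2.
  case: ifP => _; last by rewrite scaler0 addr0.
  rewrite /cojac2 W_gen_linear tmap_linear ?tswap_linear //; exact: gen_linear.
have e1 : in_z0z2 (cojac1 (k *: m + n)) =
    fun a b e => k *: in_z0z2 (cojac1 m) a b e + in_z0z2 (cojac1 n) a b e.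
  apply/funext => a'; apply/funext => b'; apply/funext => e'; rewrite /in_z0z2.
  case: ifP => _; last by rewrite scaler0 addr0.
  rewrite /cojac1 W_gen_linear tmap_linear ?tassoc_linear //; exact: gen_linear.
rewrite /cojac e1 e2 e3 (dmul_comb _ (cojac3_fin _ _ _ _) (cojac3_fin _ _ _ _)).
rewrite (dmul_comb _ (cojac2_fin _ _ _ _) (cojac2_fin _ _ _ _)).
rewrite (dmul_comb _ (cojac1_fin _ _ _ _) (cojac1_fin _ _ _ _)).
by rewrite !scalerBr !opprD [X in X + _ = _]addrACA [LHS]addrACA.
Qed.


Lemma Lmode_linear : linear (Lmode (@voc_rho R V) (@com_D R V M1) 1).
Proof.
move=> a u v; rewrite /Lmode /gen linearP.
by apply: (contract_linear (v := voc_rho V)) => b y z; rewrite linearP.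
Qed.

Lemma tform_L1 (f : X1) (g : X2) x :
  tform f g (tmap (Lmode (@voc_rho R V) (@com_D R V M1) 1) id x)
  = tform (act M1 0 omega f) g x.
Proof.
rewrite tform_tmap_l; try exact: gdual_linear; last exact: Lmode_linear.
by congr (tform _ g x); apply/funext => m; rewrite gactE.
Qed.

Lemma cointertwining_coef : @cointertwining R V M1 M2 M3 W -> is_coef copairing.
Proof.
case=> _ _ Wd WJ; split.
- exact: copairing_trilinear.
- move=> f g m e; have lt := tform_linear (gdual_linear f) (gdual_linear g).
  rewrite /gen /copairing -tform_L1 -(Wd m e) /ddz /gen.
  by rewrite (linear_Z _ _ lt).
- move=> v f g m a b e; rewrite -cojac_copairing /cojac.
  have -> : dmul (delta_z1_z2Dz0 R) (in_z0z2 (cojac1 m)) a b e =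
    dmul (delta_z0_z1Bz2 R) (in_z1z2 (cojac3 m)) a b e
    - dmul (delta_Nz0_z2Bz1 R) (in_z1z2 (cojac2 m)) a b e by rewrite WJ.
  rewrite subrr; apply: linear_0; apply: tform_linear; first exact: gdual_linear.
  by apply: tform_linear; apply: gdual_linear.
Qed.

Hypotheses (M1_fin : comodule_fin_dim M1) (M2_fin : comodule_fin_dim M2).

Lemma tform_homform_separating : separating [set ph | exists al be,
  [/\ [set ph : M1 -> C^o | exists p (f : X1), homform Posz (Posz p) f /\ ph = gform f] al,
      [set ph : M2 -> C^o | exists p (f : X2), homform Posz (Posz p) f /\ ph = gform f] be
    & ph = tform al be]].
Proof.
apply: tform_separating; apply: homform_separating => //.
- exact: gr_sum.
- exact: Posz_injective.
- exact: gr_sum.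
- exact: Posz_injective.
Qed.

Lemma tensor_homform_eq0 (x : tensor M1 M2) :
  (forall (p q : nat) (f : X1) (g : X2), homform Posz p f -> homform Posz q g ->
     tform f g x = 0) -> x = 0.
Proof.
move=> h; apply: tform_homform_separating.2 => ph.
move=> [al [be [[p [f [hf ->]]] [q [g [hg ->]]] ->]]].
exact: (h _ _ _ _ hf hg).
Qed.

Lemma tensor3_homform_eq0 (x : tensor V (tensor M1 M2)) :
  (forall r (p q : nat) (v : V') (f : X1) (g : X2), homform id r v -> homform Posz p f ->
     homform Posz q g -> tform v (tform f g) x = 0) -> x = 0.
Proof.
have sV := homform_separating (@voc_gr_sum R V) (@inj_id int) (@voc_gr_fin_dim R V).
move=> h; apply: (tform_separates sV tform_homform_separating) => _ ph [r [v [hv ->]]].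
move=> [al [be [[p [f [hf ->]]] [q [g [hg ->]]] ->]]].
exact: (h _ _ _ _ _ _ hv hf hg).
Qed.

(** The defects of the two identities are linear in [m], which is what reduces
    them to homogeneous vectors. *)
Lemma coef_cointertwining :
  (forall r (p q i : nat) (v : V') (f : X1) (g : X2) m, homform id r v -> homform Posz p f ->
     homform Posz q g -> com_gr i m ->
     coef_derivative copairing f g m /\
     forall a b e, coef_jacobi copairing v f g m a b e = 0) ->
  @cointertwining R V M1 M2 M3 W.
Proof.
move=> h; split=> // [m e|m a b e].
- apply/eqP; rewrite -subr_eq0; apply/eqP.
  pose F m := ddz id (fun e => gen W e m) e
    - tmap (Lmode (@voc_rho R V) (@com_D R V M1) 1) id (gen W e m).
  have lF : linear F.
    move=> k u v; rewrite /F /ddz !W_gen_linear (tmap_linear Lmode_linear) //.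
    rewrite scalerDr scalerBr !scalerA [k * _]mulrC opprD.
    exact: addrACA.
  apply: (graded_eq0 (gm_sum := @gr_sum M3) (f := F)) => // i.
  have [_ gi _] := component_spec (@gr_sum M3) m.
  apply: tensor_homform_eq0 => p q f g hf hg.
  have lt := tform_linear (gdual_linear f) (gdual_linear g).
  have z : homform id 0 (0 : V') by move=> *.
  have [hd _] := h 0 p q i 0 f g _ z hf hg (gi i).
  rewrite /F -scaleN1r addrC lt tform_L1 scaleN1r /ddz (linear_Z _ _ lt).
  by rewrite [X in _ + X](hd e) addNr.
- apply/eqP; rewrite -subr_eq0; apply/eqP.
  apply: (graded_eq0 (gm_sum := @gr_sum M3) (f := fun m => cojac m a b e)) => [|i].
    exact: cojac_linear.
  have [_ gi _] := component_spec (@gr_sum M3) m.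
  apply: tensor3_homform_eq0 => r p q v f g hv hf hg; rewrite cojac_copairing.
  by have [_ ->] := h r p q i v f g _ hv hf hg (gi i).
Qed.

End Cointertwining.

(** ** The intertwining side *)

Section Intertwining.
Variable Y : C -> X1 -> X2 -> X3.
Hypothesis Y_bilin : forall t, is_bilin (Y t).
Hypothesis Y_truncated : forall f g (l : C), exists T : int,
  forall t : int, T <= t -> Y (t%:~R + l) f g = 0.

Definition pairing : series := fun t f g m => Y t f g m.

Lemma pairing_trilinear : trilinear pairing.
Proof.
split=> [t f g|t f m|t g m]; first exact: gdual_linear.
- by move=> a g h; rewrite /pairing (Y_bilin t).2.
- by move=> a f h; rewrite /pairing (Y_bilin t).1.
Qed.

Definition jac1 (v : V') f g : int -> C -> X3 :=
  fun a e => gen Y e (gen (act M1) a v f) g.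
Definition jac2 (v : V') f g : int -> C -> X3 :=
  fun b e => gen Y e f (gen (act M2) b v g).
Definition jac3 (v : V') f g : int -> C -> X3 :=
  fun b e => gen (act M3) b v (gen Y e f g).

Definition jac v f g (a b : int) (e : C) : X3 :=
  dmul (delta_z0_z1Bz2 R) (in_z1z2 (jac3 v f g)) a b e
  - dmul (delta_Nz0_z2Bz1 R) (in_z1z2 (jac2 v f g)) a b e
  - dmul (delta_z1_z2Dz0 R) (in_z0z2 (jac1 v f g)) a b e.

Lemma act_truncated (M : comodule V) (v : V') (x : gdual (@com_gr R V M)) :
  exists N : int, forall k, N <= k -> act M k v x = 0.
Proof. by apply: gact_truncated => //; [apply: voc_gr_sum | apply: gr_sum]. Qed.

(** On the dual side indices increase instead: that of [Y] in the first product,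
    that of the action in the other two. *)
Lemma jac3_fin v f g a b e :
  dfin (delta_z0_z1Bz2 R) (in_z1z2 (jac3 v f g)) a b e.
Proof.
have [N hN] := Y_truncated f g (- e - 2%:R - a%:~R).
apply: (dfin_z1z2 (lo := - N) (hi := -1 - a) degree_z0_z1Bz2) => j.
move=> /delta_z0_z1Bz2_support[j0 _] S0; apply/andP; split; last by lia.
rewrite leNgt; apply: contraNN S0 => jN.
rewrite /jac3 [gen Y]/gen.
have -> : - (e - (-1 - a - j)%:~R) - 1 = (- j)%:~R + (- e - 2%:R - a%:~R) :> C.
  by rewrite !(intrB, intrN); ring.
rewrite hN; last by lia.
by rewrite /gen (linear_0 (gact_linear_r _ _ _ _)).
Qed.

Lemma jac2_fin v f g a b e :
  dfin (delta_Nz0_z2Bz1 R) (in_z1z2 (jac2 v f g)) a b e.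
Proof.
have [N hN] := act_truncated v g.
apply: (dfin_z1z2 (lo := 0) (hi := N + b + 1) degree_Nz0_z2Bz1) => j.
move=> /delta_Nz0_z2Bz1_support[j0 _] S0; rewrite j0 /= leNgt.
apply: contraNN S0 => jN.
rewrite /jac2 [gen (act M2)]/gen hN; last by lia.
by rewrite /gen (linear_0 ((Y_bilin _).2 f)).
Qed.

Lemma jac1_fin v f g a b e :
  dfin (delta_z1_z2Dz0 R) (in_z0z2 (jac1 v f g)) a b e.
Proof.
have [N hN] := act_truncated v f.
apply: (dfin_z0z2 (lo := 0) (hi := N + a + 1) degree_z1_z2Dz0) => j.
move=> /delta_z1_z2Dz0_support[j0 _] S0; rewrite j0 /= leNgt.
apply: contraNN S0 => jN.
rewrite /jac1 [gen (act M1)]/gen hN; last by lia.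
by rewrite /gen (linear_0 ((Y_bilin _).1 g)).
Qed.

Lemma jac_pairing v f g a b e m : jac v f g a b e m = coef_jacobi pairing v f g m a b e.
Proof.
pose ev (x : X3) : C^o := x m.
have lev : linear ev by apply: gdual_ev_linear.
have sub x y : ev (x - y) = ev x - ev y.
  by rewrite -scaleN1r addrC lev scaleN1r addrC.
rewrite -[LHS]/(ev _) /jac /coef_jacobi !sub.
rewrite (dmul_linear lev (jac3_fin _ _ _ _ _ _)).
rewrite (dmul_linear lev (jac2_fin _ _ _ _ _ _)).
rewrite (dmul_linear lev (jac1_fin _ _ _ _ _ _)) !in_z1z2_linear // in_z0z2_linear //.
congr (dmul _ (in_z1z2 _) a b e - _ - _).
by apply/funext => b'; apply/funext => e'; rewrite /ev /jac3 /gen gactE.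
Qed.

Lemma intertwining_jac (v : V') (f : X1) (g : X2) (a b : int) (e : C) :
  dmul (delta_z0_z1Bz2 R) (in_z1z2 (jac3 v f g)) a b e
  - dmul (delta_z0_Nz2Dz1 R) (in_z1z2 (jac2 v f g)) a b e
  = dmul (delta_z2_z1Bz0 R) (in_z0z2 (jac1 v f g)) a b e <->
  jac v f g a b e = 0.
Proof.
rewrite delta_z0_Nz2Dz1E delta_z2_z1Bz0E /jac.
by split=> [->|/eqP]; rewrite ?subrr // subr_eq0 => /eqP.
Qed.

Lemma intertwining_coef :
  @intertwining R _ (dual_module hrho M1) (dual_module hrho M2)
    (dual_module hrho M3) Y ->
  is_coef pairing.
Proof.
case=> _ _ Yd YJ; split.
- exact: pairing_trilinear.
- by move=> f g m e; have := congr1 (fun x : X3 => x m) (Yd f g e).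
- move=> v f g m a b e; rewrite -jac_pairing.
  by have /intertwining_jac -> := YJ v f g a b e.
Qed.

Lemma coef_intertwining : is_coef pairing ->
  @intertwining R _ (dual_module hrho M1) (dual_module hrho M2)
    (dual_module hrho M3) Y.
Proof.
case=> _ Yd YJ; split=> // [f g e|v f g a b e].
- by apply: gdual_ext => m; apply: Yd.
- apply/intertwining_jac; apply: gdual_ext => m.
  by rewrite jac_pairing YJ.
Qed.

End Intertwining.
End Coefficients.

(** * Cutting coefficients off at finitely many weights *)

Section Weights.
Variables (R : realType) (V : voc R) (hrho : rho_in_V2 V) (M1 M2 M3 : comodule V).
Local Notation C := R[i].
Local Notation V' := (gdual (@voc_gr R V)).
Local Notation X1 := (gdual (@com_gr R V M1)).
Local Notation X2 := (gdual (@com_gr R V M2)).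
Local Notation X3 := (gdual (@com_gr R V M3)).
Local Notation act M := (gact Posz_injective (@com_homogeneous R V M)).
Local Notation series := (C -> X1 -> X2 -> M3 -> C^o).
Local Notation omega := (GDual (homogeneous_in_gdual hrho)).
Local Notation gr_sum := (@com_gr_sum R V).

(** If L(0) acts on the component of degree n of M_i by h_i + n, then this
    number is h_1 + h_2 - h_3 for every nonzero coefficient. *)
Definition weight (t : C) (n p q : int) : C :=
  t + 1 + n%:~R - p%:~R - q%:~R.

Definition cut (S : seq C) (ka ka' : series) : Prop :=
  forall t p q n (f : X1) (g : X2) m, homform Posz p f -> homform Posz q g ->
    int_degree (@gr_sum M3) Posz n m ->
    ka' t f g m = if weight t n p q \in S then ka t f g m else 0.

(** In the weight, the degree 1 of L(-1) compensates the shift of [t] by the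
    derivative. *)
Lemma cut_derivative S ka ka' p q (n : nat) (f : X1) (g : X2) m :
  cut S ka ka' -> homform Posz p f -> homform Posz q g -> com_gr n m ->
  coef_derivative hrho ka f g m -> coef_derivative hrho ka' f g m.
Proof.
move=> cutS hf hg gm dka e.
have hm : int_degree (@gr_sum M3) Posz n m by apply: gm_int_degree.
have ho : homform id 2 (omega : V') by move=> s v /hrho h /h.
have hof := @homform_gact _ _ _ _ _ _ _ _ Posz_injective (@com_homogeneous R V M1)
  (@gr_sum M1) 0 _ _ _ _ ho hf.
rewrite /gen (cutS _ _ _ _ _ _ _ hf hg hm) (cutS _ _ _ _ _ _ _ hof hg hm).
have -> : weight (- (e + 1) - 1) n p q = weight (- e - 1) n (2 + p - 0 - 1) q.
  by rewrite /weight !(intrB, intrD); ring.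
by case: ifP => _; [apply: dka | rewrite scaler0].
Qed.

(** For homogeneous arguments all the coefficients that enter the Jacobi identity
    at given exponents have the same weight, so that the identity for [ka'] is
    either the one for [ka] or 0 = 0. *)
Lemma cut_jacobi S ka ka' r p q (n : nat) (v : V') (f : X1) (g : X2) m a b e :
  cut S ka ka' -> homform id r v -> homform Posz p f -> homform Posz q g -> com_gr n m ->
  coef_jacobi ka v f g m a b e = 0 -> coef_jacobi ka' v f g m a b e = 0.
Proof.
move=> cutS hv hf hg gm.
have hm : int_degree (@gr_sum M3) Posz n m by apply: gm_int_degree.
pose P (c : C) := (n%:Z - r - p - q)%:~R - c \in S.
have c3 a' b' e' : in_z1z2 (coef_on3 ka' v f g m) a' b' e' =
    if P (a'%:~R + b'%:~R + e') then in_z1z2 (coef_on3 ka v f g m) a' b' e' else 0.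
  rewrite /in_z1z2; case: eqP => [->|_]; last by rewrite if_same.
  have hn := @contract_homogeneous _ _ _ _ _ _ _ _ (@com_homogeneous R V M3)
    (@gr_sum M3) (- b' - 1) _ _ _ _ hv gm.
  rewrite /coef_on3 /gen (cutS _ _ _ _ _ _ _ hf hg hn).
  congr (if _ \in S then _ else _).
  by rewrite /weight !(intrB, intrD, intrN); ring.
have c2 a' b' e' : in_z1z2 (coef_on2 ka' v f g m) a' b' e' =
    if P (a'%:~R + b'%:~R + e') then in_z1z2 (coef_on2 ka v f g m) a' b' e' else 0.
  rewrite /in_z1z2; case: eqP => [->|_]; last by rewrite if_same.
  have hn := @homform_gact _ _ _ _ _ _ _ _ Posz_injective (@com_homogeneous R V M2)
    (@gr_sum M2) (- b' - 1) _ _ _ _ hv hg.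
  rewrite /coef_on2 /gen (cutS _ _ _ _ _ _ _ hf hn hm).
  congr (if _ \in S then _ else _).
  by rewrite /weight !(intrB, intrD, intrN); ring.
have c1 a' b' e' : in_z0z2 (coef_on1 ka' v f g m) a' b' e' =
    if P (a'%:~R + b'%:~R + e') then in_z0z2 (coef_on1 ka v f g m) a' b' e' else 0.
  rewrite /in_z0z2; case: eqP => [->|_]; last by rewrite if_same.
  have hn := @homform_gact _ _ _ _ _ _ _ _ Posz_injective (@com_homogeneous R V M1)
    (@gr_sum M1) (- a' - 1) _ _ _ _ hv hf.
  rewrite /coef_on1 /gen (cutS _ _ _ _ _ _ _ hn hg hm).
  congr (if _ \in S then _ else _).
  by rewrite /weight !(intrB, intrD, intrN); ring.
rewrite /coef_jacobi (dmul_cut _ _ _ (@degree_z0_z1Bz2 R) c3).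
rewrite (dmul_cut _ _ _ (@degree_Nz0_z2Bz1 R) c2).
rewrite (dmul_cut _ _ _ (@degree_z1_z2Dz0 R) c1).
by case: ifP => [//|_ _]; rewrite !subr0.
Qed.

Lemma weight_bound (S : seq C) (c : C) : exists K : nat, forall p q : nat,
  c - p%:~R - q%:~R \in S -> (p < K)%N /\ (q < K)%N.
Proof.
elim: S => [|s S [K hK]]; first by exists 0%N.
exists (maxn K (Num.bound `|complex.Re (c - s)|)) => p q; rewrite inE => /orP[/eqP e|].
  set B := Num.bound _; suff : (p + q < B)%N by lia.
  have := archi_boundP (normr_ge0 (complex.Re (c - s))); rewrite -/B.
  have -> : complex.Re (c - s) = (p + q)%:R.
    have -> : c - s = (p + q)%:R by rewrite -e natrD !pmulrn; ring.
    by rewrite pmulrn Re_int.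
  by rewrite ger0_norm ?ler0n // ltr_nat.
by move=> /hK; lia.
Qed.

Hypotheses (M1_fin : comodule_fin_dim M1) (M2_fin : comodule_fin_dim M2).

Lemma tform_0l (g : X2) (x : tensor M1 M2) : tform (0 : X1) g x = 0.
Proof. exact: linear_0 (tform_gdual_linear_l g x). Qed.

Lemma tform_0r (f : X1) (x : tensor M1 M2) : tform f (0 : X2) x = 0.
Proof. exact: linear_0 (tform_gdual_linear_r f x). Qed.

(** Only finitely many degrees [p], [q] are compatible with a weight in [S], and
    on the corresponding components a bilinear form on the duals is a tensor, by
    finite dimension. *)
Lemma cut_block (S : seq C) (ka : series) t (n : nat) m : trilinear ka ->
  exists x : tensor M1 M2, forall p q (f : X1) (g : X2),
    homform Posz p f -> homform Posz q g ->
    tform f g x = if weight t n p q \in S then ka t f g m else 0.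
Proof.
move=> [_ kag kaf].
have /choice[l1 hl1] := dual_basis (@gr_sum M1) Posz_injective M1_fin.
have /choice[l2 hl2] := dual_basis (@gr_sum M2) Posz_injective M2_fin.
have [K hK] := weight_bound S (t + 1 + n%:~R).
pose block p q := if weight t n (Posz p) (Posz q) \in S then
  \sum_(x <- l1 p) \sum_(y <- l2 q) ka t x.2 y.2 m *: tpure x.1 y.1 else 0.
exists (\sum_(p < K) \sum_(q < K) block p q) => p q f g hf hg.
have [lf lg] := (gdual_linear f, gdual_linear g); have lt := tform_linear lf lg.
case: p hf => p hf; last first.
  by rewrite (homform_eq0 (@gr_sum M1) hf) // tform_0l (linear_0 (kaf t g m)) if_same.
case: q hg => q hg; last first.
  by rewrite (homform_eq0 (@gr_sum M2) hg) // tform_0r (linear_0 (kag t f m)) if_same.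
have off p' q' : (p' != p) || (q' != q) -> tform f g (block p' q') = 0.
  move=> pq; rewrite /block; case: ifP => _; last exact: linear_0.
  rewrite (linear_bigsum _ _ _ lt) big_seq big1 // => x /(hl1 p').1[x1 _].
  rewrite (linear_bigsum _ _ _ lt) big_seq big1 // => y /(hl2 q').1[y1 _].
  rewrite (linear_Z _ _ lt) tform_pure //.
  by case/orP: pq => h; [rewrite (hf p') | rewrite (hg q')];
    rewrite ?(mulr0, mul0r, scaler0).
have on : tform f g (block p q) =
    if weight t n p q \in S then ka t f g m else 0.
  rewrite /block; case: ifP => _; last exact: linear_0.
  have [[s1 u1] [s2 u2]] := (hl1 p, hl2 q).
  rewrite [in RHS](dual_basis_expand (@gr_sum M1) Posz_injective s1 u1 hf).
  rewrite (linear_bigsum _ _ _ (kaf t g m)) (linear_bigsum _ _ _ lt).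
  apply: eq_bigr => x _; rewrite (linear_Z _ _ (kaf t g m)).
  rewrite [in RHS](dual_basis_expand (@gr_sum M2) Posz_injective s2 u2 hg).
  rewrite (linear_bigsum _ _ _ (kag t x.2 m)) (linear_bigsum _ _ _ lt) scaler_sumr.
  apply: eq_bigr => y _; rewrite (linear_Z _ _ (kag t x.2 m)) (linear_Z _ _ lt).
  rewrite tform_pure // scalerA; exact: mulrC.
rewrite (linear_bigsum _ _ _ lt).
under eq_bigr => p' _ do rewrite (linear_bigsum _ _ _ lt).
have [wS|wS] := boolP (weight t n p q \in S); last first.
  rewrite big1 // => p' _; rewrite big1 // => q' _.
  have [pq|pq] := boolP ((p' == p :> nat) && (q' == q :> nat)).
    by move: pq => /andP[/eqP -> /eqP ->]; rewrite on (negPf wS).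
  by apply: off; rewrite -negb_and.
have [pK qK] := hK p q wS.
rewrite (bigD1 (Ordinal pK)) //= (bigD1 (Ordinal qK)) //= on wS.
rewrite big1 => [|q' qq]; last by apply: off; rewrite qq orbT.
rewrite big1 ?addr0 // => p' pp; rewrite big1 // => q' _.
by apply: off; rewrite pp.
Qed.

Lemma cut_exists (S : seq C) (ka : series) : trilinear ka ->
  exists W : C -> M3 -> tensor M1 M2,
  (forall t, linear (W t)) /\ cut S ka (copairing W).
Proof.
move=> kalin; have [kam kag kaf] := kalin.
have /choice[F hF] : forall z : C * nat * M3, exists x : tensor M1 M2,
    forall p q (f : X1) (g : X2), homform Posz p f -> homform Posz q g ->
    tform f g x = if weight z.1.1 z.1.2 p q \in S then ka z.1.1 f g z.2 else 0.
  by move=> z; apply: cut_block.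
have lF t n : linear (fun m => F (t, n, m)).
  move=> a u v; apply/eqP; rewrite -subr_eq0; apply/eqP.
  apply: tensor_homform_eq0 => // p q f g hf hg.
  have lt := tform_linear (gdual_linear f) (gdual_linear g).
  rewrite -scaleN1r (linear_D _ _ lt) (linear_Z _ _ lt) lt !(hF _ _ _ _ _ hf hg) /=.
  case: ifP => _; last by rewrite !(scaler0, addr0).
  by rewrite kam scaleN1r subrr.
have /choice[W hW] : forall t, exists G : M3 -> tensor M1 M2, linear G /\
    forall n m, com_gr n m -> G m = F (t, n, m).
  by move=> t; apply: (graded_glue (@gr_sum M3) (lF t)).
exists W; split=> [t|t p q n f g]; first by case: (hW t).
have [lW eW] := hW t; have lt := tform_linear (gdual_linear f) (gdual_linear g).
move=> m hf hg; apply: (int_degree_ext (f := fun m => tform f g (W t m))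
  (g := fun m => if weight t n p q \in S then ka t f g m else 0)) => [a u v|a u v|i u <- gu].
- by rewrite lW lt.
- by case: ifP => _; rewrite ?kam // scaler0 addr0.
- by rewrite (eW _ _ gu) (hF _ _ _ _ _ hf hg).
Qed.

(** As [p] and [q] are nonnegative, the weight bounds the real part of [t] from
    below in terms of the degree of [m]. *)
Lemma supported_truncated (S : seq C) (W : C -> M3 -> tensor M1 M2) :
  (forall t, linear (W t)) ->
  (forall t (p q n : nat) (f : X1) (g : X2) m, homform Posz p f -> homform Posz q g ->
     com_gr n m -> weight t n p q \notin S -> copairing W t f g m = 0) ->
  forall m, exists r : R, forall t : C, complex.Re t < r -> W t m = 0.
Proof.
move=> lW hW m; have [s _ [_ em]] := component_sum (@gr_sum M3) m.
exists (- \sum_(z <- S) `|complex.Re z| - 1 - (\sum_(n <- s) n)%:R) => t ht.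
rewrite em (linear_bigsum _ _ _ (lW t)) big_seq big1 // => n ns.
have [_ gi _] := component_spec (@gr_sum M3) m.
apply: tensor_homform_eq0 => // p q f g hf hg.
apply: (hW t p q n f g) => //; apply/negP => wS; move: ht; rewrite ltNge => /negP; apply.
have : (n <= \sum_(n <- s) n)%N by rewrite (big_rem n) //= leq_addr.
have : `|complex.Re (weight t n p q)| <= \sum_(z <- S) `|complex.Re z|.
  by rewrite (big_rem (weight t n p q)) //= lerDl sumr_ge0.
rewrite /weight !(Re_D, Re_N) !Re_int Re_1 -(ler_nat R) -!pmulrn.
move: (\sum_(z <- S) _) (\sum_(n <- s) n)%N => A B.
rewrite ler_norml => /andP[hA _] hB; have := ler0n R p; have := ler0n R q.
move: hA hB; lra.
Qed.

Lemma cut_cointertwining S ka W : is_coef hrho ka ->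
  (forall t, linear (W t)) -> cut S ka (copairing W) -> @cointertwining R V M1 M2 M3 W.
Proof.
move=> [_ kad kaJ] lW cutW; apply: (coef_cointertwining (hrho := hrho)) => //.
  apply: (supported_truncated (S := S)) => // t p q n f g m hf hg gm wS.
  by rewrite (cutW _ _ _ _ _ _ _ hf hg (gm_int_degree _ gm)) (negPf wS).
move=> r p q n v f g m hv hf hg gm; split.
  by apply: cut_derivative cutW hf hg gm _; apply: kad.
by move=> a b e; apply: cut_jacobi cutW hv hf hg gm _; apply: kaJ.
Qed.


(** ** Finiteness of the weights *)

Definition weights_in (S : seq C) (ka : series) : Prop :=
  forall t (p q n : nat) (f : X1) (g : X2) m, homform Posz p f -> homform Posz q g ->
    com_gr n m -> ka t f g m != 0 -> weight t n p q \in S.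

(** The cut-offs of [ka] at single weights that occur are linearly independent
    cointertwining operators, so there are at most [d] of them. *)
Lemma finite_weights d ka : has_dim (@cointertwining R V M1 M2 M3) d ->
  is_coef hrho ka -> exists S, weights_in S ka.
Proof.
move=> hd coef; apply: contrapT => noS; have [kalin _ _] := coef.
pose occurs s := exists t (p q n : nat) (f : X1) (g : X2) m,
  [/\ homform Posz p f, homform Posz q g, com_gr n m, ka t f g m != 0
    & weight t n p q = s].
have fresh (S : seq C) : exists2 s, s \notin S & occurs s.
  apply: contrapT => none; apply: noS; exists S => t p q n f g m hf hg hm nz.
  apply: contrapT => /negP wS; apply: none; exists (weight t n p q) => //.
  by exists t, p, q, n, f, g, m.
have [S uS [sizeS occS]] : exists2 S : seq C, uniq S &
    size S = d.+1 /\ forall s, s \in S -> occurs s.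
  elim: (d.+1) => [|k [S uS [sizeS occS]]]; first by exists [::].
  have [s sS occs] := fresh S; exists (s :: S); first by rewrite /= sS.
  split=> [|s']; first by rewrite /= sizeS.
  by rewrite inE => /orP[/eqP ->|/occS].
have /choice[W hW] := fun s => cut_exists [:: s] kalin.
have [u [i ui] su] := @has_dim_dependent _ _ _ _ d.+1 (fun i => W S`_i) hd (ltnSn d)
  (fun i => cut_cointertwining coef (hW S`_i).1 (hW S`_i).2).
have iS : S`_i \in S by rewrite mem_nth // sizeS.
have [t [p [q [n [f [g [m [hf hg hm nz wt]]]]]]]] := occS _ iS.
have lt := tform_linear (gdual_linear f) (gdual_linear g).
have ev : linear (fun w : C -> M3 -> tensor M1 M2 => tform f g (w t m)).
  by move=> a w w'; rewrite -lt.
have := congr1 (fun w : C -> M3 -> tensor M1 M2 => tform f g (w t m)) su.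
rewrite (linear_bigsum _ _ _ ev) [X in _ = X](linear_0 ev).
have val j : tform f g (W S`_j t m) = if S`_i == S`_j then ka t f g m else 0.
  have [_ c] := hW S`_j; rewrite -[LHS]/(copairing (W S`_j) t f g m).
  by rewrite (c _ _ _ _ _ _ _ hf hg (gm_int_degree _ hm)) wt inE.
rewrite (bigD1 i) //= big1 => [|j ji]; rewrite (linear_Z _ _ ev) /= val.
  by rewrite eqxx addr0 => /eqP; rewrite scaler_eq0 (negPf ui) (negPf nz).
rewrite nth_uniq ?sizeS // [_ == _ :> nat]eq_sym -[_ == _ :> nat]/(j == i) (negPf ji).
exact: scaler0.
Qed.

(** The weights being finitely many, only finitely many degrees of [M3] occur
    for each [t], and none when the real part of [t] is large. *)
Lemma degree_bound S ka : trilinear ka -> weights_in S ka ->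
  forall f g, exists B : R, forall t (n : nat) m, com_gr n m ->
    ka t f g m != 0 -> n%:R <= B - complex.Re t.
Proof.
move=> [_ kag kaf] wS f g.
have [sf ef] := gdual_component_sum (@gr_sum M1) f.
have [sg eg] := gdual_component_sum (@gr_sum M2) g.
(* n = w - t - 1 + p + q with w in S and p, q among the degrees of f and g. *)
exists (\sum_(z <- S) `|complex.Re z| + (\sum_(p <- sf) p)%:R + (\sum_(q <- sg) q)%:R).
move=> t n m hm nz; rewrite leNgt; apply: contraNN nz => hn; apply/eqP.
rewrite ef (linear_bigsum _ _ _ (kaf t g m)) big_seq big1 // => p psf.
rewrite eg (linear_bigsum _ _ _ (kag t _ m)) big_seq big1 // => q qsg.
have hf : homform Posz p (gdual_component (@gr_sum M1) f p).
  by apply: homform_component Posz_injective _ _.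
have hg : homform Posz q (gdual_component (@gr_sum M2) g q).
  by apply: homform_component Posz_injective _ _.
apply/eqP; apply: contraLR hn => /(wS _ _ _ _ _ _ _ hf hg hm) wt.
have : `|complex.Re (weight t n p q)| <= \sum_(z <- S) `|complex.Re z|.
  by rewrite (big_rem (weight t n p q)) //= lerDl sumr_ge0.
have : (p <= \sum_(p <- sf) p)%N by rewrite (big_rem p) //= leq_addr.
have : (q <= \sum_(q <- sg) q)%N by rewrite (big_rem q) //= leq_addr.
rewrite /weight !(Re_D, Re_N) !Re_int Re_1 -!(ler_nat R) -!pmulrn -leNgt.
move: (\sum_(z <- S) _) (\sum_(p <- sf) p)%N (\sum_(q <- sg) q)%N => A B B'.
rewrite ler_norml => hq hp /andP[_]; lra.
Qed.

(** ** The correspondence *)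

Lemma cointertwining_to_intertwining d W :
  has_dim (@cointertwining R V M1 M2 M3) d -> @cointertwining R V M1 M2 M3 W ->
  exists2 Y : C -> X1 -> X2 -> X3,
    @intertwining R _ (dual_module hrho M1) (dual_module hrho M2)
      (dual_module hrho M3) Y & copairing W = pairing Y.
Proof.
move=> hd hW; have [lW tW _ _] := hW.
have coef := cointertwining_coef hrho lW tW hW.
have [kam kag kaf] := copairing_trilinear lW.
have [S wS] := finite_weights hd coef.
have bound := degree_bound (copairing_trilinear lW) wS.
have in_gdual t f g : copairing W t f g \in gdual_pred (@com_gr R V M3).
  apply/asboolP; split; first exact: kam.
  have [B hB] := bound f g; pose N := Num.bound `|B - complex.Re t|.
  apply: (@sub_finite_set _ _ `I_N) => [n [m hm nz]|]; last exact: finite_II.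
  rewrite /= -(ltr_nat R); apply: le_lt_trans (hB t n m hm nz) _.
  by apply: le_lt_trans (ler_norm _) (archi_boundP _).
pose Y t f g : X3 := GDual (in_gdual t f g).
have eY : copairing W = pairing Y by [].
have Y_bilin t : is_bilin (Y t).
  split=> [g a f h|f a g h]; apply: gdual_ext => m; rewrite gdualE.
    exact: kaf.
  exact: kag.
exists Y => //; apply: coef_intertwining => //.
move=> f g l; have [B hB] := bound f g.
exists (Num.bound `|B - complex.Re l|)%:Z => t ht; apply: gdual_ext.
apply: (graded_ext (@gr_sum M3)) => [||n m hm].
- exact: gdual_linear.
- by move=> a u v /=; rewrite scaler0 addr0.
apply/eqP; rewrite -[X in _ == X]/(0 : C) -[X in X == _]/(copairing W (t%:~R + l) f g m).
apply: contraT => nz; have := hB _ _ _ hm nz; rewrite Re_D Re_int.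
have := archi_boundP (normr_ge0 (B - complex.Re l)).
have := ler_norm (B - complex.Re l); have := ler0n R n.
move: ht; rewrite -(ler_int R) -pmulrn; lra.
Qed.

Lemma intertwining_to_cointertwining d (Y : C -> X1 -> X2 -> X3) :
  has_dim (@cointertwining R V M1 M2 M3) d ->
  @intertwining R _ (dual_module hrho M1) (dual_module hrho M2)
    (dual_module hrho M3) Y ->
  exists2 W, @cointertwining R V M1 M2 M3 W & copairing W = pairing Y.
Proof.
move=> hd hY; have [bY tY _ _] := hY.
have coef := intertwining_coef bY tY hY; have [kalin _ _] := coef.
have [S wS] := finite_weights hd coef.
have [W [lW cW]] := cut_exists S kalin.
exists W; first exact: cut_cointertwining coef lW cW.
have [kam kag kaf] := kalin; have [wam wag waf] := copairing_trilinear lW.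
apply/funext => t; apply/funext => f; apply/funext => g; apply/funext => m.
move: f; apply: (gdual_linear_ext (@gr_sum M1) Posz_injective) => [||p f hf].
- exact: waf.
- exact: kaf.
move: g; apply: (gdual_linear_ext (@gr_sum M2) Posz_injective) => [||q g hg].
- exact: wag.
- exact: kag.
move: m; apply: (graded_ext (@gr_sum M3)) => [||n m hm].
- exact: wam.
- exact: kam.
rewrite (cW _ _ _ _ _ _ _ hf hg (gm_int_degree _ hm)).
case: ifP => // /negbT wt; apply/esym/eqP.
by apply: contraNT wt; apply: wS hf hg hm.
Qed.

Lemma has_dim_intertwining d : has_dim (@cointertwining R V M1 M2 M3) d ->
  has_dim (@intertwining R _ (dual_module hrho M1) (dual_module hrho M2)
    (dual_module hrho M3)) d.
Proof.
move=> hd; apply: (has_dim_transfer (rel := fun W (Y : C -> X1 -> X2 -> X3) =>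
  copairing W = pairing Y)) (hd).
- move=> a W W' Y Y' e e'; apply/funext => t; apply/funext => f; apply/funext => g.
  apply/funext => m; have lt := tform_linear (gdual_linear f) (gdual_linear g).
  rewrite -[LHS]/(tform f g (a *: W t m + W' t m)) lt.
  by rewrite -[tform f g (W t m)]/(copairing W t f g m) e
    -[tform f g _]/(copairing W' t f g m) e'.
- move=> W e; apply/funext => t; apply/funext => m.
  apply: tensor_homform_eq0 => // p q f g _ _.
  by rewrite -[LHS]/(copairing W t f g m) e.
- move=> Y e; apply/funext => t; apply/funext => f; apply/funext => g.
  apply: gdual_ext => m; rewrite -[LHS]/(pairing Y t f g m) -e.
  exact: linear_0 (tform_linear (gdual_linear f) (gdual_linear g)).
- by move=> W; apply: cointertwining_to_intertwining hd.
- by move=> Y; apply: intertwining_to_cointertwining hd.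
Qed.

End Weights.

Theorem lemma5p4 (R : realType) (V : voc R)
  (hsimple : voc_simple V) (hcorational : corational V) (hrho : rho_in_V2 V)
  (considered : comodule V -> Prop)
  (hfin_dim : forall M, considered M -> comodule_fin_dim M)
  (hfusion : forall M1 M2 M3, considered M1 -> considered M2 -> considered M3 ->
     co_fusion M1 M2 M3 <> None)
  (Mi Mj Mk : comodule V)
  (hi : considered Mi) (hj : considered Mj) (hk : considered Mk) :
  co_fusion Mi Mj Mk =
  fusion (dual_module hrho Mi) (dual_module hrho Mj) (dual_module hrho Mk).
Proof.
have [d hd] := dimension_has_dim (hfusion _ _ _ hi hj hk).
rewrite /co_fusion /fusion (has_dim_dimension hd); apply/esym/has_dim_dimension.
by apply: has_dim_intertwining hd; apply: hfin_dim.
Qed.
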